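(* Let $\mathcal{A}=\{a_1,\ldots,a_N\}$ be a set of $N$ distinct points in $[0,1]^2$. Let $\mathcal{X}$ be a random subset of size $n$ of $\mathcal{A}$, chosen according to a distribution $\mu$ on the subsets of size $n$ of $\mathcal{A}$, with inhomogeneity coefficient $\rho_n(\mu)<1$. Let $S(\{x_1,\ldots,x_n\})$ denote the sum of the edge lengths of the minimal Steiner tree of $\{x_1,\ldots,x_n\}$. Then for any $t\ge0$, $$\mathbb{P}(|S(\mathcal{X})-\mathbb{M}(S)|\ge t)\le4\exp\left(-\frac{t^2(1-\rho_n(\mu))}{520000}\right),$$ where $\mathbb{M}(S)$ denotes the median of $S(\mathcal{X})$.
   Context: The minimal Steiner tree of a finite set $H$ of points in the plane is a connected graph (tree) of minimal total Euclidean edge length among all such graphs whose vertices are points of the plane and whose vertex set contains $H$ (additional vertices are allowed). Here $2\le n\le N$. The inhomogeneity coefficient of a probability distribution $\mu$ on the $n$-element subsets of $\mathcal{A}$ is $$\rho_n(\mu):=n\left(r_{n,1}(\mu)+(N-n)\,r_{n,2}(\mu)\right),$$ where, writing $\mathcal{B}\cup b$ for $\mathcal{B}\cup\{b\}$, $$r_{n,1}(\mu):=\sup_{\mathcal{B}\subset\mathcal{A},\,|\mathcal{B}|=n-1}\ \sup_{b\in\mathcal{A}\setminus\mathcal{B}}\frac{\mu(\mathcal{B}\cup b)}{\sum_{b'\in\mathcal{A}\setminus\mathcal{B}}\mu(\mathcal{B}\cup b')},$$ $$r_{n,2}(\mu):=\sup_{\mathcal{B}\subset\mathcal{A},\,|\mathcal{B}|=n-2}\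 \sup_{b,c,d}\left|\frac{\mu(\mathcal{B}\cup b\cup d)}{\sum_{d'\in\mathcal{A}\setminus(\mathcal{B}\cup b)}\mu(\mathcal{B}\cup b\cup d')}-\frac{\mu(\mathcal{B}\cup c\cup d)}{\sum_{d'\in\mathcal{A}\setminus(\mathcal{B}\cup c)}\mu(\mathcal{B}\cup c\cup d')}\right|,$$ the inner supremum in $r_{n,2}$ being over distinct $b,c,d\in\mathcal{A}\setminus\mathcal{B}$ (supremum over the empty set is $0$). It is assumed that all the denominators are positive (for every $\mathcal{B}$ and $b,c$), so that $\rho_n(\mu)$ is well defined. *)

(* Defs.v *)
From mathcomp Require Import all_boot all_order all_algebra.
From mathcomp Require Import finmap.
From mathcomp Require Import all_classical all_reals all_analysis.

Set Implicit Arguments.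
Unset Strict Implicit.
Unset Printing Implicit Defensive.

Import Order.TTheory GRing.Theory Num.Theory.

Local Open Scope ring_scope.

Section Inhomogeneity.
Context {R : realType} {T : finType}.
Implicit Types (mu : {set T} -> R) (B : {set T}).

Definition subset_distribution n mu : Prop :=
  [/\ forall B, 0 <= mu B,
      forall B, #|B| != n -> mu B = 0
    & \sum_(B : {set T}) mu B = 1].

Definition Pr mu (E : pred {set T}) : R := \sum_(B : {set T} | E B) mu B.

(* A median need not be unique. *)
Definition is_median mu (f : {set T} -> R) (m : R) : Prop :=
  2^-1 <= Pr mu (fun B => f B <= m) /\ 2^-1 <= Pr mu (fun B => m <= f B).

Definition extension_mass mu B : R := \sum_(b | b \notin B) mu (b |: B).

Definition transition mu B b : R := mu (b |: B) / extension_mass mu B.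

(* The quantities below are nonnegative for a distribution mu, so maxima
   started at 0 are suprema, with value 0 on the empty range. *)
Definition r1 n mu : R :=
  \big[Num.max/0]_(B : {set T} | #|B| == (n - 1)%N)
    \big[Num.max/0]_(b | b \notin B) transition mu B b.

Definition r2 n mu : R :=
  \big[Num.max/0]_(B : {set T} | #|B| == (n - 2)%N)
    \big[Num.max/0]_(b | b \notin B)
      \big[Num.max/0]_(c | (c \notin B) && (c != b))
        \big[Num.max/0]_(d | [&& d \notin B, d != b & d != c])
          `|transition mu (b |: B) d - transition mu (c |: B) d|.

(* These are all the denominators in r1 and also those in r2, where the
   conditioning sets b |: B and c |: B have n - 1 elements. *)
Definition positive_denominators n mu : Prop :=
  forall B, #|B| = (n - 1)%N -> 0 < extension_mass mu B.

Definition inhomogeneity n mu : R :=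
  n%:R * (r1 n mu + (#|T| - n)%:R * r2 n mu).

End Inhomogeneity.

Section Steiner.
Context {R : realType}.
Implicit Types (H V : {fset R * R}).

Definition in_unit_square (p : R * R) : Prop :=
  0 <= p.1 <= 1 /\ 0 <= p.2 <= 1.

Definition euclidean_dist (p q : R * R) : R :=
  Num.sqrt ((p.1 - q.1) ^+ 2 + (p.2 - q.2) ^+ 2).

Definition connected_graph_through H V (e : rel V) : Prop :=
  [/\ (H `<=` V)%fset, symmetric e, irreflexive e
    & forall x y : V, connect e x y].

(* Each undirected edge is counted twice in the double sum. *)
Definition total_length V (e : rel V) : R :=
  2^-1 * \sum_(x : V) \sum_(y : V | e x y) euclidean_dist (val x) (val y).

Definition minimal_steiner_tree H V (e : rel V) : Prop :=
  connected_graph_through H e /\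
  forall (W : {fset R * R}) (g : rel W), connected_graph_through H g ->
    total_length e <= total_length g.

(* Taking an infimum makes this total without presupposing that a minimal tree
   exists; steiner_lengthE identifies it with the length of any such tree. *)
Definition steiner_length H : R :=
  inf [set l : R | exists V (e : rel V),
    connected_graph_through H e /\ l = total_length e]%classic.

Lemma steiner_lengthE H V (e : rel V) :
  minimal_steiner_tree H e -> steiner_length H = total_length e.
Proof.
move=> [He emin]; apply/le_anti/andP; split.
  apply: ge_inf; last by exists V, e.
  by exists (total_length e) => _ [W [g [Hg ->]]]; exact: emin.
apply: lb_le_inf; first by exists (total_length e), V, e.
by move=> _ [W [g [Hg ->]]]; exact: emin.
Qed.

End Steiner.

(* Main.v *)
(* The resampling chain [P] removes a uniform element of the random set and adds
   one according to [mu]. For a positive density [h], let [chi2 h] be the sum over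
   (n-1)-sets of the conditional variances of [h], weighted by [1 / h]. If [h] varies by
   a factor at most [1 + tau / 50] between neighbouring sets, tau = 1 - rho, this
   regularity is preserved by [P] and [chi2 (P h) <= (1 - tau / 2n) chi2 h]: on
   every link the two-point kernel is within rho / n of a rank one kernel.
   Telescoping E[phi (P^k h)] for h proportional to e^(l phi) bounds the tilted
   mean of [phi] by E[phi] + 6 K l / tau, when sum_b (phi X - phi (X \ b))^2 <= K and
   l phi is (tau / 200)-Lipschitz; Jensen's inequality then gives a Gaussian tail.

   The Steiner length S is not Lipschitz on the scale 1 / l, so it is replaced
   by its truncation [min over V of S V + delta #|X \ V|], at distance at most
   K / (4 delta) from S; since delta may be taken of order 1 / t, this loses
   only a multiple of t. The quadratic bound for the truncation comes from an order
   of the points with bounded sum of squared consecutive distances. *)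
Require Import Defs.
From mathcomp Require Import all_boot all_order all_algebra.
From mathcomp Require Import finmap.
From mathcomp Require Import all_classical all_reals all_analysis.
From mathcomp Require Import ring lra.
Import Order.TTheory GRing.Theory Num.Theory.
Local Open Scope ring_scope.

Set Implicit Arguments.
Unset Strict Implicit.
Unset Printing Implicit Defensive.

(** The hypothesis on [phi] bounds a sum of squared increments, so the decay of P^k h has to be
    measured in an L2 sense. The weight [1 / h] in [chi2] comes from the pairing: Cauchy-Schwarz
    against [chi2 h] leaves the [h]-weighted squared increments of [phi], whose mean is at most K
    E[h], and [P] preserves E[h]. Moreover g^2 / W is jointly convex in (g, W), so numerator and
    denominator can be averaged together. With lam = rho / n and perfectly constant weights, one
    step would contract by ((n-1)/n)^2 (1 + lam) / (1 - lam), which is at most 1 - tau / n; the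
    regularity of [h] keeps the weights so close to constant on a link that half of this gain
    survives. As [chi2] decays like a square q^(2k), the telescoping terms decay like q^k, and their
    sum, of order n / tau, cancels the factor 1 / n of a single step. *)

(** Cauchy-Schwarz by tangents: with s = G / S the left side is the sum of the values 2 s g - s^2 W,
    each at most g^2 / W. Positivity of [W] is asked only where [p] does not vanish, because the
    diagonal of a link does not correspond to n-element sets. *)
Lemma sum_sqr_div_le (R : realFieldType) (I : finType) (P : pred I) (p g W : I -> R) :
  (forall i, P i -> 0 <= p i) -> (forall i, P i -> p i != 0 -> 0 < W i) ->
  0 < \sum_(i | P i) p i * W i ->
  (\sum_(i | P i) p i * g i) ^+ 2 / (\sum_(i | P i) p i * W i) <=
    \sum_(i | P i) p i * (g i ^+ 2 / W i).
Proof.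
move=> p0 W0 S0; set S := \sum_(i | P i) p i * W i in S0 *.
set G := \sum_(i | P i) p i * g i; pose s := G / S.
have -> : G ^+ 2 / S = \sum_(i | P i) p i * (2 * s * g i - s ^+ 2 * W i).
  transitivity (2 * s * G - s ^+ 2 * S); first by rewrite /s; field; rewrite gt_eqF.
  rewrite /G /S !mulr_sumr -sumrB; apply: eq_bigr => i _; ring.
apply: ler_sum => i Pi.
have [->|pi0] := eqVneq (p i) 0; first by rewrite !mul0r.
apply: ler_wpM2l; first exact: p0.
have Wi := W0 i Pi pi0.
rewrite ler_pdivlMr // -subr_ge0.
have -> : g i ^+ 2 - (2 * s * g i - s ^+ 2 * W i) * W i = (g i - s * W i) ^+ 2 by ring.
exact: sqr_ge0.
Qed.

(** * Reversible kernels on a link *)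

Section TwoPointChain.
(** Intended reading: [D] is the complement of an (n-2)-set B and w x y is the mass of B with x and
    y added, so that [deg x] is the extension mass of B with x added and [Q] the corresponding
    transition. *)
Variables (R : realFieldType) (T : finType) (D : {set T}) (w : T -> T -> R).
Hypothesis w_ge0 : forall x y, 0 <= w x y.
Hypothesis w_sym : forall x y, w x y = w y x.
Hypothesis w_diag : forall x, w x x = 0.
Hypothesis w_out : forall x y, x \notin D -> w x y = 0.

Let deg x := \sum_y w x y.
Let Q x y := w x y / deg x.
Let Qf (u : T -> R) x := \sum_y Q x y * u y.
Let ip (u v : T -> R) := \sum_x deg x * (u x * v x).

Hypothesis deg_gt0 : forall x, x \in D -> 0 < deg x.

Let deg_ge0 x : 0 <= deg x. Proof. exact: sumr_ge0. Qed.

Let deg_out x : x \notin D -> deg x = 0.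
Proof. by move=> xD; rewrite /deg big1 // => y _; exact: w_out. Qed.

Let degQ x y : deg x * Q x y = w x y.
Proof.
have [xD|xD] := boolP (x \in D); last by rewrite deg_out // mul0r w_out.
by rewrite /Q mulrC divfK // gt_eqF // deg_gt0.
Qed.

Let Q_ge0 x y : 0 <= Q x y. Proof. by rewrite divr_ge0. Qed.

Let sumQ x : x \in D -> \sum_y Q x y = 1.
Proof. by move=> xD; rewrite -mulr_suml mulfV // gt_eqF // deg_gt0. Qed.

Let ipQ u v : ip u (Qf v) = \sum_x \sum_y w x y * (u x * v y).
Proof.
apply: eq_bigr => x _; rewrite /Qf !mulr_sumr; apply: eq_bigr => y _.
rewrite -(degQ x y); ring.
Qed.

Let ipQC u v : ip u (Qf v) = ip v (Qf u).
Proof.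
rewrite !ipQ exchange_big /=; apply: eq_bigr => x _; apply: eq_bigr => y _.
by rewrite w_sym (mulrC (u y)).
Qed.

(** Schur's test: bound 2 |t x| |t y| by the sum of the squares; symmetry of [s] makes the two
    resulting sums equal. *)
Lemma schur_le (s : T -> T -> R) (t : T -> R) :
  (forall x y, 0 <= s x y) -> (forall x y, s x y = s y x) ->
  \sum_x \sum_y s x y * (`|t x| * `|t y|) <= \sum_x t x ^+ 2 * \sum_y s x y.
Proof.
move=> s0 sC.
have E1 : \sum_x t x ^+ 2 * (\sum_y s x y) = \sum_x \sum_y s x y * t x ^+ 2.
  by apply: eq_bigr => x _; rewrite mulr_sumr; apply: eq_bigr => y _; rewrite mulrC.
have E2 : \sum_x \sum_y s x y * t x ^+ 2 = \sum_x \sum_y s x y * t y ^+ 2.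
  rewrite exchange_big; apply: eq_bigr => x _; apply: eq_bigr => y _.
  by rewrite sC.
rewrite E1.
suff : 2 * (\sum_x \sum_y s x y * (`|t x| * `|t y|)) <=
  \sum_x \sum_y s x y * t x ^+ 2 + \sum_x \sum_y s x y * t y ^+ 2 by rewrite -E2; lra.
rewrite mulr_sumr -big_split /=; apply: ler_sum => x _.
rewrite mulr_sumr -big_split /=; apply: ler_sum => y _.
rewrite -(real_normK (num_real (t x))) -(real_normK (num_real (t y))).
have := mulr_ge0 (s0 x y) (sqr_ge0 (`|t x| - `|t y|)); lra.
Qed.

Section Influence.
Variables (r1 r2 : R) (m : nat).
Hypothesis r2_ge0 : 0 <= r2.
Hypothesis cardD : #|D| = m.+2.
Hypothesis Q_le : forall x y, x \in D -> y \in D -> x != y -> Q x y <= r1.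
Hypothesis Q_infl : forall x c y, x \in D -> c \in D -> y \in D ->
  x != c -> y != x -> y != c -> `|Q x y - Q c y| <= r2.

Let lam := r1 + m%:R * r2.
Let Z := \sum_x deg x.
Let pi x := deg x / Z.
(** Deviation of [Q] from the rank one kernel whose rows are its stationary law; on functions of
    [pi]-mean zero, [A] and [Q] act alike. *)
Let A x y := Q x y - pi y.

Let Z_gt0 : 0 < Z.
Proof.
have : (0 < #|D|)%N by rewrite cardD.
case/card_gt0P => x xD; rewrite /Z (bigD1 x) //=.
by apply: ltr_pwDl; [exact: deg_gt0 | exact: sumr_ge0].
Qed.

Let pi_ge0 x : 0 <= pi x. Proof. by rewrite divr_ge0 // ltW. Qed.
Let pi_out x : x \notin D -> pi x = 0.
Proof. by move=> xD; rewrite /pi deg_out // mul0r. Qed.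
Let sum_pi : \sum_x pi x = 1.
Proof. by rewrite -mulr_suml mulfV // gt_eqF. Qed.

Let Q_out x y : y \notin D -> Q x y = 0.
Proof. by move=> yD; rewrite /Q w_sym w_out // mul0r. Qed.

Let Q_diag x : Q x x = 0. Proof. by rewrite /Q w_diag mul0r. Qed.

Let r1_ge0 : 0 <= r1.
Proof.
have : (1 < #|D|)%N by rewrite cardD.
case/card_gt1P => x [y [xD yD xy]].
exact: le_trans (Q_ge0 x y) (Q_le xD yD xy).
Qed.

Let Q_le_r1 x y : x \in D -> Q x y <= r1.
Proof.
move=> xD; have [yD|yD] := boolP (y \in D); last by rewrite Q_out.
by have [<-|xy] := eqVneq x y; [rewrite Q_diag | exact: Q_le].
Qed.

Let piQ y : \sum_c pi c * Q c y = pi y.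
Proof.
under eq_bigr => c _ do rewrite /pi mulrAC degQ w_sym.
by rewrite -mulr_suml.
Qed.

Let pi_le_r1 y : pi y <= r1.
Proof.
rewrite -piQ -[r1]mul1r -sum_pi mulr_suml; apply: ler_sum => c _.
have [cD|cD] := boolP (c \in D); first by rewrite ler_wpM2l ?Q_le_r1.
by rewrite pi_out // !mul0r.
Qed.

(** By stationarity [A x y] is the [pi]-average over c of Q x y - Q c y. The term c = x uses the
    zero diagonal in the form Q x y - Q x y = 0, the term c = y is pi y * Q x y since Q y y = 0, and
    [r2] bounds all others. *)
Let A_le x y : x \in D -> y \in D -> y != x ->
  `|A x y| <= r2 * (1 - pi x - pi y) + pi y * Q x y.
Proof.
move=> xD yD yx.
have -> : A x y = \sum_c pi c * (Q x y - Q c y).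
  under eq_bigr => c _ do rewrite mulrBr.
  by rewrite sumrB piQ -mulr_suml sum_pi mul1r.
rewrite (bigD1 y) //= (bigD1 x) /=; last by rewrite eq_sym.
rewrite subrr mulr0 add0r Q_diag subr0 addrC.
apply: le_trans (ler_normD _ _) _.
apply: lerD; last by rewrite (ger0_norm (mulr_ge0 (pi_ge0 _) (Q_ge0 _ _))).
apply: le_trans (ler_norm_sum _ _ _) _.
have -> : 1 - pi x - pi y = \sum_(c | (c != y) && (c != x)) pi c.
  rewrite -sum_pi (bigD1 y) //= (bigD1 x) /=; first by ring.
  by rewrite eq_sym.
rewrite mulr_sumr; apply: ler_sum => c /andP[cy cx].
have [cD|cD] := boolP (c \in D); last by rewrite pi_out // mul0r mulr0 normr0.
rewrite normrM ger0_norm // mulrC ler_wpM2r //; apply: Q_infl => //.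
  by rewrite eq_sym.
by rewrite eq_sym.
Qed.

(** This is where the shape of the inhomogeneity coefficient enters. Over the m + 1 points y other
    than x, the weights 1 - pi x - pi y add up to m (1 - pi x), which gives at most m r2, and the
    terms pi y * Q x y add up to at most r1. *)
Let A_row x : x \in D -> \sum_(y | y != x) `|A x y| <= lam.
Proof.
move=> xD.
have -> : \sum_(y | y != x) `|A x y| = \sum_(y in D | y != x) `|A x y|.
  rewrite [LHS](bigID (mem D)) /= [X in _ + X]big1 ?addr0.
    by apply: eq_bigl => y; rewrite andbC.
  by move=> y /andP[_ yD]; rewrite /A Q_out // pi_out // subrr normr0.
apply: (@le_trans _ _ (\sum_(y in D | y != x) (r2 * (1 - pi x - pi y) + pi y * Q x y))).
  by apply: ler_sum => y /andP[yD yx]; exact: A_le.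
rewrite big_split /= -mulr_sumr addrC /lam; apply: lerD.
  rewrite -[r1]mul1r -sum_pi mulr_suml [leRHS](bigID [pred y | (y \in D) && (y != x)]) /=.
  rewrite -[leLHS]addr0; apply: lerD.
    by apply: ler_sum => y _; rewrite ler_wpM2l ?Q_le_r1.
  by apply: sumr_ge0 => y _; exact: mulr_ge0.
rewrite mulrC ler_wpM2r // sumrB sumr_const.
have -> : \sum_(y in D | y != x) pi y = 1 - pi x.
  rewrite -sum_pi [in RHS](bigD1 x) //= addrAC subrr add0r.
  rewrite [RHS](bigID (mem D)) /= [X in _ + X]big1 ?addr0.
    by apply: eq_bigl => y; rewrite andbC.
  by move=> y /andP[_ yD]; rewrite pi_out.
have -> : #|[pred y in D | y != x]| = m.+1.
  have := cardsD1 x D; rewrite xD cardD => -[->]; apply: eq_card => y.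
  by rewrite !inE andbC.
rewrite -[(1 - pi x) *+ _]mulr_natl -natr1.
have := mulr_ge0 (ler0n R m) (pi_ge0 x); lra.
Qed.

Let lam_ge0 : 0 <= lam.
Proof. by apply: addr_ge0 => //; exact: mulr_ge0. Qed.

Let degA_sym x y : deg x * A x y = deg y * A y x.
Proof.
by rewrite /A !mulrBr !degQ w_sym /pi; congr (_ - _); ring.
Qed.

Let ipQA c t : \sum_x deg x * t x = 0 ->
  \sum_x c x * (deg x * (t x * Qf t x)) =
  \sum_x \sum_y c x * (deg x * A x y * (t x * t y)).
Proof.
move=> t0; apply: eq_bigr => x _.
have -> : Qf t x = \sum_y A x y * t y.
  rewrite /A; under [RHS]eq_bigr => y _ do rewrite mulrBl.
  rewrite sumrB -[Qf t x]subr0; congr (_ - _).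
  under eq_bigr => y _ do rewrite /pi mulrAC.
  by rewrite -mulr_suml t0 mul0r.
rewrite !mulr_sumr; apply: eq_bigr => y _; ring.
Qed.

Lemma chain_form_le t : \sum_x deg x * t x = 0 -> ip t (Qf t) <= lam * ip t t.
Proof.
move=> t0.
have := ipQA (fun=> 1) t0.
under eq_bigr do rewrite mul1r.
under [in RHS]eq_bigr => x _ do under eq_bigr => y _ do rewrite mul1r.
rewrite -/(ip t (Qf t)) => ->.
pose s x y := if y == x then 0 else `|deg x * A x y|.
have s0 x y : 0 <= s x y by rewrite /s; case: ifP.
have sC x y : s x y = s y x by rewrite /s eq_sym degA_sym.
apply: (@le_trans _ _ (\sum_x \sum_y s x y * (`|t x| * `|t y|))).
  apply: ler_sum => x _; apply: ler_sum => y _; rewrite /s.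
  case: eqVneq => [->|yx].
    rewrite mul0r /A Q_diag sub0r mulrN mulNr oppr_le0.
    by apply: mulr_ge0 (mulr_ge0 _ _) _ => //; rewrite -expr2 sqr_ge0.
  by rewrite -!normrM ler_norm.
apply: le_trans (schur_le _ s0 sC) _.
rewrite /ip mulr_sumr; apply: ler_sum => x _.
have -> : \sum_y s x y = deg x * \sum_(y | y != x) `|A x y|.
  rewrite mulr_sumr [RHS]big_mkcond; apply: eq_bigr => y _.
  by rewrite /s if_neg; case: ifP => // _; rewrite normrM ger0_norm.
have -> : lam * (deg x * (t x * t x)) = t x ^+ 2 * (deg x * lam) by ring.
apply: ler_wpM2l; first exact: sqr_ge0.
have [xD|xD] := boolP (x \in D); first by apply: ler_wpM2l => //; exact: A_row.
by rewrite deg_out // !mul0r.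
Qed.

(** Under weights of arbitrary sign the diagonal of [A] has to be kept; it adds at most r1 <= lam to
    a row sum, whence the factor 2. *)
Lemma chain_wform_le (c t : T -> R) (C : R) :
  \sum_x deg x * t x = 0 -> (forall x, x \in D -> `|c x| <= C) ->
  \sum_x c x * (deg x * (t x * Qf t x)) <= C * (2 * lam) * ip t t.
Proof.
move=> t0 cC; rewrite ipQA //.
pose s x y := `|deg x * A x y|.
have s0 x y : 0 <= s x y by exact: normr_ge0.
have sC x y : s x y = s y x by rewrite /s degA_sym.
have C0 : 0 <= C.
  have : (0 < #|D|)%N by rewrite cardD.
  by case/card_gt0P => x xD; exact: le_trans (normr_ge0 _) (cC x xD).
apply: (@le_trans _ _ (C * \sum_x \sum_y s x y * (`|t x| * `|t y|))).
  rewrite mulr_sumr; apply: ler_sum => x _; rewrite mulr_sumr; apply: ler_sum => y _.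
  apply: le_trans (ler_norm _) _; rewrite normrM (normrM (deg x * A x y)).
  rewrite (normrM (t x)); have [xD|xD] := boolP (x \in D); last by rewrite /s deg_out // !mul0r normr0 !mul0r !mulr0.
  apply: ler_wpM2r; [exact: mulr_ge0 | exact: cC].
rewrite -mulrA ler_wpM2l //; apply: le_trans (schur_le _ s0 sC) _.
rewrite /ip mulr_sumr; apply: ler_sum => x _.
have [xD|xD] := boolP (x \in D); last first.
  rewrite deg_out // mul0r mulr0 big1 ?mulr0 // => y _.
  by rewrite /s deg_out // mul0r normr0.
have -> : \sum_y s x y = deg x * \sum_y `|A x y|.
  by rewrite mulr_sumr; apply: eq_bigr => y _; rewrite /s normrM ger0_norm.
rewrite (bigD1 x) //= {1}/A Q_diag sub0r normrN (ger0_norm (pi_ge0 x)).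
rewrite -expr2 mulrCA [leRHS]mulrCA ler_wpM2l // mulrC ler_wpM2r ?sqr_ge0 //.
have := A_row xD; have := pi_le_r1 x.
have : 0 <= m%:R * r2 by rewrite mulr_ge0.
rewrite /lam; lra.
Qed.

Variable W : T -> T -> R.
Let F x := \sum_y Q x y * W x y.
Variable rr : R.
Hypothesis rr_ge1 : 1 <= rr.
Hypothesis W_gt0 : forall x y, x \in D -> y \in D -> x != y -> 0 < W x y.
Hypothesis F_le : forall x y, x \in D -> y \in D -> F x <= rr * F y.
Hypothesis lam_lt1 : lam < 1.

Let W_gt0' x y : x \in D -> w x y != 0 -> 0 < W x y.
Proof.
move=> xD w0; apply: W_gt0 => //.
  by apply: contraNT w0 => yD; rewrite w_sym w_out.
by apply: contraNneq w0 => ->; rewrite w_diag.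
Qed.

Let F_gt0 x : x \in D -> 0 < F x.
Proof.
move=> xD.
have QW0 y : 0 <= Q x y * W x y.
  have [E|w0] := eqVneq (w x y) 0; first by rewrite /Q E !mul0r.
  by rewrite mulr_ge0 // ltW // W_gt0'.
have : exists y, w x y != 0.
  apply/existsP; apply: contraT; rewrite negb_exists => /forallP all0.
  have := deg_gt0 xD; rewrite /deg big1 ?ltxx // => y _.
  by apply/eqP; move: (all0 y); rewrite negbK.
case=> y w0; rewrite /F (bigD1 y) //=; apply: ltr_pwDl; last exact: sumr_ge0.
rewrite mulr_gt0 ?W_gt0' // divr_gt0 ?deg_gt0 //.
by rewrite lt0r w0 w_ge0.
Qed.

Let t x := F x - Qf F x.

Let t_sum0 : \sum_x deg x * t x = 0.
Proof.
rewrite /t; under eq_bigr => x _ do rewrite mulrBr.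
rewrite sumrB; apply/eqP; rewrite subr_eq0; apply/eqP.
have -> : \sum_x deg x * Qf F x = \sum_x \sum_y w x y * F y.
  by apply: eq_bigr => x _; rewrite mulr_sumr; apply: eq_bigr => y _; rewrite mulrA degQ.
rewrite exchange_big; apply: eq_bigr => y _; rewrite -mulr_suml /deg.
by congr (_ * _); apply: eq_bigr => x _.
Qed.

(** Spectrally: theta / (1 - theta) <= lam / (1 - lam) for every eigenvalue theta <= lam. The
    nonnegative expression in the proof, a square plus (1 - lam) times the gap in [chain_form_le],
    gives this without diagonalising. *)
Let form_QF_t : ip t (Qf F) <= lam / (1 - lam) * ip t t.
Proof.
pose a := (\sum_x deg x * F x) / Z; pose G x := F x - a.
have QG x : x \in D -> Qf G x = Qf F x - a.
  move=> xD; rewrite /Qf /G; under eq_bigr => y _ do rewrite mulrBr.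
  by rewrite sumrB -mulr_suml sumQ // mul1r.
have G0 : \sum_x deg x * G x = 0.
  rewrite /G; under eq_bigr => x _ do rewrite mulrBr.
  rewrite sumrB -mulr_suml -/Z /a mulrC divfK ?subrr // gt_eqF //.
have HG := chain_form_le G0.
have Et : ip t (Qf F) = ip t (Qf G).
  apply/eqP; rewrite -subr_eq0; apply/eqP; rewrite /ip -sumrB.
  transitivity (a * \sum_x deg x * t x); last by rewrite t_sum0 mulr0.
  rewrite mulr_sumr; apply: eq_bigr => x _.
  have [xD|xD] := boolP (x \in D); last by rewrite deg_out // !mul0r mulr0 subrr.
  by rewrite QG //; ring.
have tG x : x \in D -> t x = G x - Qf G x by move=> xD; rewrite QG // /t /G; ring.
have : 0 <= ip (fun x => lam * G x - Qf G x) (fun x => lam * G x - Qf G x)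
            + (1 - lam) * (lam * ip G G - ip G (Qf G)).
  apply: addr_ge0; last by rewrite mulr_ge0 // subr_ge0 // ltW.
  by apply: sumr_ge0 => x _; rewrite mulr_ge0 // -expr2 sqr_ge0.
have -> : ip (fun x => lam * G x - Qf G x) (fun x => lam * G x - Qf G x)
            + (1 - lam) * (lam * ip G G - ip G (Qf G)) =
          lam * ip t t - (1 - lam) * ip t (Qf G).
  rewrite /ip !mulr_sumr -sumrB mulr_sumr -big_split -sumrB /=.
  apply: eq_bigr => x _.
  have [xD|xD] := boolP (x \in D); last by rewrite deg_out //; ring.
  rewrite tG //; ring.
rewrite subr_ge0 Et => H.
by rewrite mulrAC ler_pdivlMr ?subr_gt0 // mulrC.
Qed.

Let QfB u v x : Qf (fun y => u y - v y) x = Qf u x - Qf v x.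
Proof. by rewrite -sumrB; apply: eq_bigr => y _; rewrite mulrBr. Qed.

(* Writing [t = F - QF], the bracket is [t b + (QF b - QF e)]; only the first
   part is of order one, and by convexity its weighted norm is at most the
   right-hand sum with constant 1. The rest carries a factor [lam]. *)
Lemma two_point_contraction :
  \sum_e \sum_b w e b * ((F b - Qf F e) ^+ 2 / F b) <=
  (1 + 2 * rr * (lam / (1 - lam)) + 4 * lam * (rr - 1)) *
  \sum_b \sum_d w b d * ((W b d - F d) ^+ 2 / W b d).
Proof.
set Jl := \sum_b \sum_d w b d * ((W b d - F d) ^+ 2 / W b d).
have [x0 x0D F0min] : exists2 x0, x0 \in D & forall b, b \in D -> F x0 <= F b.
  have : (0 < #|D|)%N by rewrite cardD.
  case/card_gt0P => y yD; case: (@arg_minP _ R T y (mem D) F yD) => x xD xm.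
  by exists x.
have F00 := F_gt0 x0D.
pose TT := \sum_b deg b * (t b ^+ 2 / F b).
(* For fixed b, [t b] is the [Q]-average of W b d - F d and [F b] that of W b d, so [sum_sqr_div_le]
   applies row by row. *)
have TTle : TT <= Jl.
  apply: ler_sum => b _.
  have [bD|bD] := boolP (b \in D); last first.
    by rewrite deg_out // mul0r big1 // => d _; rewrite w_out // mul0r.
  have -> : t b = \sum_d Q b d * (W b d - F d).
    by rewrite /t /F -sumrB; apply: eq_bigr => d _; rewrite mulrBr.
  under [leRHS]eq_bigr => d _ do rewrite -degQ -mulrA.
  rewrite -mulr_sumr ler_wpM2l //.
  apply: sum_sqr_div_le => [//|d _ Q0|]; last exact: F_gt0.
  apply: W_gt0' => //; apply: contraNneq Q0 => E; by rewrite /Q E mul0r.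
have TT0 : 0 <= TT.
  apply: sumr_ge0 => b _.
  have [bD|bD] := boolP (b \in D); last by rewrite deg_out // mul0r.
  by rewrite mulr_ge0 // divr_ge0 ?sqr_ge0 // ltW // F_gt0.
have tt_le : ip t t / F x0 <= rr * TT.
  rewrite ler_pdivrMr // mulrAC mulr_sumr; apply: ler_sum => b _.
  have [bD|bD] := boolP (b \in D); last by rewrite deg_out // !(mul0r,mulr0).
  have Fb := F_gt0 bD; rewrite -expr2.
  have -> : rr * F x0 * (deg b * (t b ^+ 2 / F b)) =
            deg b * t b ^+ 2 * (rr * F x0 / F b) by ring.
  rewrite -[leLHS]mulr1; apply: ler_wpM2l.
    by apply: mulr_ge0 => //; exact: sqr_ge0.
  by rewrite ler_pdivlMr // mul1r F_le.
have split_sum : \sum_e \sum_b w e b * ((F b - Qf F e) ^+ 2 / F b) =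
    TT + 2 * (\sum_b (F b)^-1 * (deg b * (t b * Qf t b)))
    + \sum_e \sum_b w e b * ((Qf F b - Qf F e) ^+ 2 / F b).
  have E1 : TT = \sum_e \sum_b w e b * (t b ^+ 2 / F b).
    rewrite exchange_big; apply: eq_bigr => b _; rewrite -mulr_suml /deg.
    by congr (_ * _); apply: eq_bigr => e _.
  have E2 : \sum_b (F b)^-1 * (deg b * (t b * Qf t b)) =
      \sum_e \sum_b w e b * (t b * (Qf F b - Qf F e) / F b).
    rewrite exchange_big; apply: eq_bigr => b _.
    have -> : deg b * (t b * Qf t b) =
        t b * \sum_e w e b * (Qf F b - Qf F e).
      rewrite mulrCA; congr (_ * _).
      have -> : deg b * Qf t b = deg b * (Qf F b - Qf (Qf F) b) by rewrite -QfB.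
      under eq_bigr => e _ do rewrite mulrBr w_sym -[in X in _ - X]degQ.
      rewrite sumrB -mulr_suml mulrBr; congr (_ - _).
      by rewrite mulr_sumr; apply: eq_bigr => e _; rewrite mulrA.
    by rewrite !mulr_sumr; apply: eq_bigr => e _; ring.
  rewrite E1 E2 mulr_sumr -!big_split /=; apply: eq_bigr => e _.
  rewrite mulr_sumr -!big_split /=; apply: eq_bigr => b _.
  by rewrite /t; ring.
(* The weight 1 / F b is replaced by its maximum 1 / F x0; the difference is at most (1 - 1 / rr) /
   F x0 and is paid for by [chain_wform_le]. *)
have cross : \sum_b (F b)^-1 * (deg b * (t b * Qf t b)) <=
    ip t (Qf t) / F x0 + 2 * lam * (rr - 1) * TT.
  have -> : \sum_b (F b)^-1 * (deg b * (t b * Qf t b)) =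
     ip t (Qf t) / F x0 +
     \sum_b ((F b)^-1 - (F x0)^-1) * (deg b * (t b * Qf t b)).
    by rewrite mulr_suml -big_split /=; apply: eq_bigr => b _; ring.
  rewrite lerD2l.
  apply: le_trans (@chain_wform_le _ t ((F x0)^-1 * (1 - rr^-1)) t_sum0 _) _.
    move=> b bD; have Fb := F_gt0 bD.
    rewrite distrC ger0_norm; last by rewrite subr_ge0 lef_pV2 ?F0min.
    rewrite mulrBr mulr1 lerD2l lerN2 -invfM lef_pV2 ?posrE ?mulr_gt0 //.
      by rewrite mulrC F_le.
    exact: lt_le_trans ltr01 rr_ge1.
  have rr0 : 0 < rr by exact: lt_le_trans ltr01 rr_ge1.
  have -> : (F x0)^-1 * (1 - rr^-1) * (2 * lam) * ip t t =
     (1 - rr^-1) * (2 * lam) * (ip t t / F x0) by ring.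
  have -> : 2 * lam * (rr - 1) * TT = (1 - rr^-1) * (2 * lam) * (rr * TT).
    by field; rewrite gt_eqF.
  apply: ler_wpM2l tt_le; rewrite mulr_ge0 ?mulr_ge0 // subr_ge0.
  by rewrite invf_le1.
(* Once 1 / F b is bounded by 1 / F x0, this is twice the Dirichlet form of QF, that is 2 <QF, QF -
   QQF>. *)
have third : \sum_e \sum_b w e b * ((Qf F b - Qf F e) ^+ 2 / F b) <=
    2 * ip (Qf F) (Qf t) / F x0.
  apply: (@le_trans _ _ ((\sum_e \sum_b w e b * (Qf F b - Qf F e) ^+ 2) / F x0)).
    rewrite mulr_suml; apply: ler_sum => e _; rewrite mulr_suml; apply: ler_sum => b _.
    rewrite mulrA.
    have [bD|bD] := boolP (b \in D); last by rewrite w_sym w_out // !mul0r.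
    apply: ler_wpM2l; first by apply: mulr_ge0 => //; exact: sqr_ge0.
    by rewrite lef_pV2 ?posrE ?F0min ?F_gt0.
  rewrite ler_wpM2r ?invr_ge0 ?(ltW F00) //.
  have -> : ip (Qf F) (Qf t) = ip (Qf F) (Qf F) - ip (Qf F) (Qf (Qf F)).
    by rewrite /ip -sumrB; apply: eq_bigr => x _; rewrite QfB; ring.
  rewrite (ipQ (Qf F) (Qf F)).
  have E1 : ip (Qf F) (Qf F) = \sum_e \sum_b w e b * Qf F b ^+ 2.
    rewrite exchange_big; apply: eq_bigr => b _; rewrite -mulr_suml expr2.
    by congr (_ * _); apply: eq_bigr => e _.
  have E2 : ip (Qf F) (Qf F) = \sum_e \sum_b w e b * Qf F e ^+ 2.
    by apply: eq_bigr => b _; rewrite -mulr_suml expr2.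
  have -> : forall a c : R, 2 * (a - c) = a + a - 2 * c by move=> a c; ring.
  rewrite {1}E1 E2 mulr_sumr -big_split -sumrB /=; apply: ler_sum => e _.
  rewrite mulr_sumr -big_split -sumrB /=; apply: ler_sum => b _.
  by rewrite le_eqVlt; apply/orP; left; apply/eqP; ring.
(* The constant-weight parts of the two previous bounds combine to <t, QF>, which is what
   [form_QF_t] controls. *)
have flat : ip t (Qf t) + ip (Qf F) (Qf t) = ip t (Qf F).
  rewrite [RHS]ipQC /ip -big_split; apply: eq_bigr => x _.
  by rewrite /t /=; ring.
rewrite split_sum; apply: (@le_trans _ _ ((1 + 2 * rr * (lam / (1 - lam))
    + 4 * lam * (rr - 1)) * TT)); last first.
  apply: ler_wpM2l TTle.
  have : 0 <= rr * (lam / (1 - lam)).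
    by rewrite mulr_ge0 ?divr_ge0 ?subr_ge0 ?(ltW lam_lt1) // (le_trans ler01).
  have : 0 <= lam * (rr - 1) by rewrite mulr_ge0 // subr_ge0.
  lra.
have mainle : ip t (Qf F) / F x0 <= rr * (lam / (1 - lam)) * TT.
  rewrite -mulrA mulrCA; apply: le_trans (_ : _ <= lam / (1 - lam) * (ip t t / F x0)) _.
    by rewrite mulrA ler_wpM2r ?invr_ge0 ?(ltW F00).
  by apply: ler_wpM2l tt_le; rewrite divr_ge0 // subr_ge0 ltW.
have E3 : ip t (Qf t) / F x0 + ip (Qf F) (Qf t) / F x0 = ip t (Qf F) / F x0.
  by rewrite -mulrDl flat.
move: cross third mainle E3; rewrite -(mulrA 2 (ip _ _)).
move: (ip t (Qf t) / F x0) (ip (Qf F) (Qf t) / F x0) (ip t (Qf F) / F x0) => p q v.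
move: (\sum_b (F b)^-1 * _) (\sum_e \sum_b _) => y z.
move=> hc ht hm he.
have -> : (1 + 2 * rr * (lam / (1 - lam)) + 4 * lam * (rr - 1)) * TT =
  TT + 2 * (rr * (lam / (1 - lam)) * TT) + 2 * (2 * lam * (rr - 1) * TT) by ring.
lra.
Qed.

End Influence.
End TwoPointChain.

(** At s = 1 the left side is ((N-1)/N)^2 (N + rho) / (N - rho), at most 1 - (1 - rho) / N. The
    excess eta = s - 1 costs about 9 eta / N, and eta <= (1 - rho) / 24 keeps that below half of the
    gain. *)
Lemma contraction_factor_le (R : realFieldType) (N rho s : R) :
  2 <= N -> 0 <= rho -> rho < 1 -> 1 <= s -> s - 1 <= (1 - rho) / 24 ->
  N^-1 * ((N - 1) * s / ((N - 1) * s + 1)) *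
    (1 + 2 * s * (rho / N / (1 - rho / N)) + 4 * (rho / N) * (s - 1)) * (N - 1)
  <= 1 - (1 - rho) / (2 * N).
Proof.
move=> N2 r0 r1 s1 sr.
have N0 : 0 < N by lra.
have Nr : 0 < N - rho by lra.
set eta := s - 1 in sr *.
have e0 : 0 <= eta by rewrite /eta; lra.
have sE : s = 1 + eta by rewrite /eta; lra.
have A_le : (N-1)*s/((N-1)*s+1) <= (N - 1) / N * (1 + eta / N).
  have d0 : 0 < (N - 1) * s + 1 by nra.
  rewrite ler_pdivrMr //.
  have -> : (N - 1) / N * (1 + eta / N) * ((N - 1) * s + 1) =
    (N - 1) * ((N + eta) * ((N - 1) * s + 1) / N ^+ 2) by field; rewrite gt_eqF.
  apply: ler_wpM2l; first by lra.
  rewrite ler_pdivlMr ?exprn_gt0 // sE; nra.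
pose k := rho / (N - rho).
have kE : rho / N / (1 - rho / N) = k by rewrite /k; field; rewrite !gt_eqF // -?mulrN.
have k_le : k <= 2 / N.
  rewrite /k ler_pdivrMr // mulrAC ler_pdivlMr //; nra.
have k0 : 0 <= k by rewrite divr_ge0 // ltW.
have L_le : 1 + 2 * s * k + 4 * (rho / N) * eta <= (1 + 2 * k) + 8 * (eta / N).
  have : 2 * eta * k <= 4 * (eta / N) by have := ler_wpM2l e0 k_le; lra.
  have : (rho / N) * eta <= eta / N by rewrite mulrAC ler_wpM2r ?invr_ge0 ?(ltW N0) //; nra.
  rewrite sE; lra.
have main : ((N - 1) / N) ^+ 2 * (1 + 2 * k) <= 1 - (1 - rho) / N.
  have -> : 1 + 2 * k = (N + rho) / (N - rho) by rewrite /k; field; rewrite gt_eqF.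
  have -> : ((N - 1) / N) ^+ 2 * ((N + rho) / (N - rho)) =
     ((N - 1) ^+ 2 * (N + rho)) / (N ^+ 2 * (N - rho)) by field; rewrite !gt_eqF.
  have d0 : 0 < N ^+ 2 * (N - rho) by rewrite mulr_gt0 ?exprn_gt0.
  rewrite ler_pdivrMr //.
  have -> : (1 - (1 - rho) / N) * (N ^+ 2 * (N - rho)) = (N - (1 - rho)) * N * (N - rho) by field; rewrite gt_eqF.
  rewrite -subr_ge0.
  have -> : (N - (1 - rho)) * N * (N - rho) - (N - 1) ^+ 2 * (N + rho) =
    (1 - rho) * ((N - 1) ^+ 2 + rho * N) + (N - 1) by ring.
  have : 0 <= (1 - rho) * ((N - 1) ^+ 2 + rho * N).
    apply: mulr_ge0; first by lra.
    by rewrite addr_ge0 ?sqr_ge0 // mulr_ge0 // ltW.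
  lra.
rewrite kE.
set L := 1 + 2 * s * k + _ in L_le *.
set A := _ / _ in A_le *.
have u0 : 0 <= (N - 1) / N by rewrite divr_ge0 //; lra.
have u1 : (N - 1) / N <= 1 by rewrite ler_pdivrMr //; lra.
have v0 : 0 <= eta / N by rewrite divr_ge0 // ltW.
have L0 : 0 <= L by rewrite /L; have : 0 <= rho / N by [rewrite divr_ge0 // ltW]; nra.
have -> : N^-1 * A * L * (N - 1) = (N - 1) / N * A * L by ring.
have v1 : eta / N <= (1 - rho) / N / 24.
  by rewrite mulrAC ler_wpM2r ?invr_ge0 ?(ltW N0).
have -> : (1 - rho) / (2 * N) = (1 - rho) / N / 2 by field; rewrite gt_eqF.
have w1 : (1 - rho) / N <= 1 by rewrite ler_pdivrMr //; lra.
apply: (@le_trans _ _ (((N - 1) / N) ^+ 2 * (1 + eta / N) * L)).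
  rewrite expr2 -(mulrA ((N - 1) / N) ((N - 1) / N)) ler_wpM2r // ler_wpM2l //.
apply: (@le_trans _ _ ((1 + eta / N) * (1 - (1 - rho) / N + 8 * (eta / N)))).
  rewrite -mulrA mulrCA ler_wpM2l //; first by lra.
  apply: le_trans (ler_wpM2l _ L_le) _; first exact: sqr_ge0.
  rewrite mulrDr; apply: lerD => //.
  have : ((N - 1) / N) ^+ 2 <= 1 by rewrite exprn_ile1.
  nra.
move: (eta / N) ((1 - rho) / N) v0 v1 w1 => x y; nra.
Qed.

(** * Double counting of pairs of a set and a point *)

Section SetSums.
Variables (V : nmodType) (T : finType).

Lemma sum_setD1_setU1 (H : {set T} -> T -> V) :
  \sum_(X : {set T}) \sum_(e in X) H (X :\ e) e =
  \sum_(B : {set T}) \sum_(e | e \notin B) H B e.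
Proof.
rewrite !pair_big_dep /=.
rewrite (reindex_onto (fun p : {set T} * T => (p.2 |: p.1, p.2))
  (fun p : {set T} * T => (p.1 :\ p.2, p.2))) /=; last first.
  by move=> [X e] /= eX; rewrite finset.setD1K.
apply: eq_big => [[B e]|[B e] /= /andP[_ /eqP[<-]]] /=.
  have -> /= : e \in e |: B by rewrite !inE eqxx.
  apply/eqP/idP => [[<-]|eB]; first by rewrite !inE eqxx.
  by rewrite setU1K.
by rewrite finset.setD1K // !inE eqxx.
Qed.

Lemma sum_setD1_card (k : nat) (H : {set T} -> T -> V) : (0 < k)%N ->
  \sum_(X : {set T} | #|X| == k) \sum_(e in X) H (X :\ e) e =
  \sum_(B : {set T} | #|B| == k.-1) \sum_(e | e \notin B) H B e.
Proof.
move=> k0.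
have := sum_setD1_setU1 (fun B e => if #|B| == k.-1 then H B e else 0).
move=> E; transitivity (\sum_(X : {set T}) \sum_(e in X)
   (if #|X :\ e| == k.-1 then H (X :\ e) e else 0)); last first.
  rewrite E [RHS]big_mkcond; apply: eq_bigr => B _.
  by case: eqP => // _; rewrite big1.
rewrite big_mkcond; apply: eq_bigr => X _; case: eqP => [Xk|/eqP Xk].
  by apply: eq_bigr => e eX; move: Xk; rewrite (cardsD1 e) eX add1n => <- /=; rewrite eqxx.
rewrite big1 // => e eX; case: eqP => // Xe.
by move: Xk; rewrite (cardsD1 e) eX add1n Xe prednK ?eqxx.
Qed.

End SetSums.

(** * The resampling chain *)

Section SubsetDynamics.
Variables (R : realType) (T : finType) (n : nat) (mu : {set T} -> R).
Hypothesis n_ge2 : (2 <= n)%N.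
Hypothesis n_leT : (n <= #|T|)%N.
Hypothesis mu_distr : subset_distribution n mu.
Hypothesis mu_pos : positive_denominators n mu.
Implicit Types (B X : {set T}) (h : {set T} -> R).

Let rho := inhomogeneity n mu.
Let m := (#|T| - n)%N.
Let lam := r1 n mu + m%:R * r2 n mu.
Let tau := 1 - rho.
Local Notation tr := (transition mu).

Hypothesis rho_lt1 : rho < 1.

Let n_gt0 : 0 < n%:R :> R. Proof. by rewrite ltr0n (leq_trans _ n_ge2). Qed.
Let n_ge2R : 2 <= n%:R :> R. Proof. by rewrite ler_nat. Qed.
Let n_pred : (n - 1 = (n - 2).+1)%N. Proof. by rewrite -subSn // subSS. Qed.

Lemma distr_ge0 B : 0 <= mu B. Proof. by case: mu_distr. Qed.

Lemma distr_card B : #|B| != n -> mu B = 0. Proof. by case: mu_distr => _ + _; apply. Qed.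
Let mu_ge0 := distr_ge0.
Let mu0 := distr_card.

(** For b in B the set b |: B is B itself, which is too small to be charged; hence sums over the
    added point may run over all of [T]. *)
Let mu_in B b : #|B| = (n - 1)%N -> b \in B -> mu (b |: B) = 0.
Proof.
move=> cB bB; apply: mu0; rewrite (_ : b |: B = B).
  by rewrite cB neq_ltn subn1 ltn_predL (leq_trans _ n_ge2).
by apply/finset.setUidPr; rewrite finset.sub1set.
Qed.

Let massE B : #|B| = (n - 1)%N -> extension_mass mu B = \sum_b mu (b |: B).
Proof.
move=> cB; rewrite /extension_mass [RHS](bigID [pred b | b \notin B]) /=.
by rewrite [X in _ + X]big1 ?addr0 // => b /negbNE bB; exact: mu_in.
Qed.

Let tr_ge0 B c : 0 <= tr B c.
Proof. by rewrite divr_ge0 // sumr_ge0. Qed.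

Let tr_in B c : #|B| = (n - 1)%N -> c \in B -> tr B c = 0.
Proof. by move=> cB cB'; rewrite /transition mu_in // mul0r. Qed.

Let sum_tr B : #|B| = (n - 1)%N -> \sum_c tr B c = 1.
Proof.
by move=> cB; rewrite -mulr_suml -massE // mulfV // gt_eqF // mu_pos.
Qed.

Let mu_tr B b : #|B| = (n - 1)%N -> mu (b |: B) = extension_mass mu B * tr B b.
Proof. by move=> cB; rewrite /transition mulrC divfK // gt_eqF // mu_pos. Qed.

Let r1_ge0 : 0 <= r1 n mu. Proof. exact: bigmax_ge_id. Qed.
Let r2_ge0 : 0 <= r2 n mu. Proof. exact: bigmax_ge_id. Qed.

Let tr_le B b : #|B| = (n - 1)%N -> b \notin B -> tr B b <= r1 n mu.
Proof.
move=> cB bB; rewrite /r1.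
apply: le_trans (_ : _ <= \big[Num.max/0]_(b0 | b0 \notin B) tr B b0) _.
  exact: le_bigmax_cond.
by apply: (le_bigmax_cond _ (fun B => \big[Num.max/0]_(b0 | b0 \notin B) tr B b0)); apply/eqP.
Qed.

Let tr_infl B b c d : #|B| = (n - 2)%N -> b \notin B -> c \notin B -> d \notin B ->
  c != b -> d != b -> d != c -> `|tr (b |: B) d - tr (c |: B) d| <= r2 n mu.
Proof.
move=> cB bB cB' dB cb db dc; rewrite /r2.
apply: le_trans (le_bigmax_cond _ (fun d => `|tr (b |: B) d - tr (c |: B) d|) (_ : [&& d \notin B, d != b & d != c])) _.
  by rewrite dB db dc.
apply: le_trans (le_bigmax_cond _ (fun c => \big[Num.max/0]_(d | [&& d \notin B, d != b & d != c])
          `|tr (b |: B) d - tr (c |: B) d|) (_ : (c \notin B) && (c != b))) _.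
  by rewrite cB' cb.
apply: le_trans (le_bigmax_cond _ (fun b => \big[Num.max/0]_(c | (c \notin B) && (c != b))
        \big[Num.max/0]_(d | [&& d \notin B, d != b & d != c])
          `|tr (b |: B) d - tr (c |: B) d|) bB) _.
by apply: (le_bigmax_cond _ (fun B => \big[Num.max/0]_(b | b \notin B)
      \big[Num.max/0]_(c | (c \notin B) && (c != b))
        \big[Num.max/0]_(d | [&& d \notin B, d != b & d != c])
          `|tr (b |: B) d - tr (c |: B) d|)); apply/eqP.
Qed.

Definition cond_mean h B : R := \sum_c tr B c * h (c |: B).
Definition resample h X : R := n%:R^-1 * \sum_(e in X) cond_mean h (X :\ e).
Local Notation E_ := cond_mean.
Local Notation P := resample.

Definition pos_on h := forall X, #|X| = n -> 0 < h X.
Definition log_lipschitz (r : R) h := forall B, #|B| = (n - 1)%N ->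
  forall b c, b \notin B -> c \notin B -> h (b |: B) <= r * h (c |: B).
Definition lipschitz (L : R) h := forall B, #|B| = (n - 1)%N ->
  forall b c, b \notin B -> c \notin B -> `|h (b |: B) - h (c |: B)| <= L.

Let cardU B b : #|B| = (n - 1)%N -> b \notin B -> #|b |: B| = n.
Proof. by move=> cB bB; rewrite cardsU1 bB cB add1n subn1 prednK // (leq_trans _ n_ge2). Qed.

Let cardU2 B b : #|B| = (n - 2)%N -> b \notin B -> #|b |: B| = (n - 1)%N.
Proof. by move=> cB bB; rewrite cardsU1 bB cB add1n n_pred. Qed.

Let cardD B e : #|B| = (n - 1)%N -> e \in B -> #|B :\ e| = (n - 2)%N.
Proof. by move=> cB eB; move: cB; rewrite (cardsD1 e B) eB add1n n_pred => -[]. Qed.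

Let mean_le h B a : #|B| = (n - 1)%N ->
  (forall c, c \notin B -> h (c |: B) <= a) -> E_ h B <= a.
Proof.
move=> cB ha; rewrite -[a]mul1r -(sum_tr cB) mulr_suml; apply: ler_sum => c _.
have [cB'|cB'] := boolP (c \in B); first by rewrite tr_in // !mul0r.
by rewrite ler_wpM2l // ha.
Qed.

Let mean_ge h B a : #|B| = (n - 1)%N ->
  (forall c, c \notin B -> a <= h (c |: B)) -> a <= E_ h B.
Proof.
move=> cB ha; rewrite -[a]mul1r -(sum_tr cB) mulr_suml; apply: ler_sum => c _.
have [cB'|cB'] := boolP (c \in B); first by rewrite tr_in // !mul0r.
by rewrite ler_wpM2l // ha.
Qed.

Let mean_gt0 h B : #|B| = (n - 1)%N -> pos_on h -> 0 < E_ h B.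
Proof.
move=> cB hp.
have /existsP[c c0] : [exists c, tr B c != 0].
  apply: contraT; rewrite negb_exists => /forallP all0.
  have := sum_tr cB; rewrite big1 => [/eqP|c _]; first by rewrite eq_sym oner_eq0.
  by apply/eqP; move: (all0 c); rewrite negbK.
have cB' : c \notin B by apply: contra c0 => cB'; rewrite tr_in.
rewrite /cond_mean (bigD1 c) //=; apply: ltr_pwDl.
  by rewrite mulr_gt0 ?hp ?cardU // lt0r c0 tr_ge0.
apply: sumr_ge0 => d _; have [dB|dB] := boolP (d \in B); first by rewrite tr_in // mul0r.
by rewrite mulr_ge0 // ltW // hp // cardU.
Qed.

(** Singles out the removal of [b]: its term [E_ h B] is common to all neighbours b |: B, and this
    common term is the source of the regularity and Lipschitz estimates for [P]. *)
Lemma resampleU h B b : #|B| = (n - 1)%N -> b \notin B ->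
  P h (b |: B) = n%:R^-1 * (E_ h B + \sum_(e in B) E_ h (b |: (B :\ e))).
Proof.
move=> cB bB; rewrite /resample; congr (_ * _).
rewrite big_setU1 //= setU1K //; congr (_ + _); apply: eq_bigr => e eB.
congr (cond_mean _ _); apply/setP => x; rewrite !inE.
by case: (eqVneq x b) => // ->; rewrite andbT /=; apply: contraNneq bB => ->.
Qed.

Lemma resample_gt0 h : pos_on h -> pos_on (P h).
Proof.
move=> hp X cX; have : (0 < #|X|)%N by rewrite cX (leq_trans _ n_ge2).
case/card_gt0P => e eX; rewrite /resample mulr_gt0 ?invr_gt0 // (bigD1 e) //=.
have c1 f : f \in X -> #|X :\ f| = (n - 1)%N.
  by move=> fX; move: cX; rewrite (cardsD1 f X) fX add1n subn1 => <-.
apply: ltr_pwDl; first by rewrite mean_gt0 // c1.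
by apply: sumr_ge0 => f /andP[fX _]; rewrite ltW // mean_gt0 // c1.
Qed.

Section Link.
Variable B : {set T}.
Hypothesis cardB : #|B| = (n - 2)%N.

(** Adding c to b |: B and adding b to c |: B gives the same set. As both transition laws have mass
    one, [h] may be centred at its value there, so the difference of the laws acts only through the
    points d outside both sets, where [r2] applies. A general r serves the multiplicative estimate,
    r = 1 the additive one. *)
Lemma cond_mean_sub h r b c : b \notin B -> c \notin B -> c != b ->
  E_ h (b |: B) - r * E_ h (c |: B) =
  \sum_(d | d \notin b |: (c |: B))
    (tr (b |: B) d * (h (d |: (b |: B)) - r * h (d |: (c |: B)))
     + r * ((tr (b |: B) d - tr (c |: B) d) *
            (h (d |: (c |: B)) - h (c |: (b |: B)))))
  - (r - 1) * (tr (b |: B) c * h (c |: (b |: B))).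
Proof.
move=> bB cB cb.
have cbB : c \notin b |: B by rewrite !inE negb_or cb.
have bcB : b \notin c |: B by rewrite !inE negb_or eq_sym cb.
have split_b (f : T -> R) : (forall d, d \in b |: B -> f d = 0) ->
    \sum_d f d = f c + \sum_(d | d \notin b |: (c |: B)) f d.
  move=> f0; rewrite (bigD1 c) //=; congr (_ + _).
  rewrite (bigID [pred d | d \in b |: (c |: B)]) /= big1 ?add0r.
    by apply: eq_bigl => d; rewrite !inE; case: eqP; rewrite ?andbF ?orbT.
  by move=> d /andP[dc]; rewrite !inE (negPf dc) /= => dB; rewrite f0 // !inE.
have split_c (f : T -> R) : (forall d, d \in c |: B -> f d = 0) ->
    \sum_d f d = f b + \sum_(d | d \notin b |: (c |: B)) f d.
  move=> f0; rewrite (bigD1 b) //=; congr (_ + _).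
  rewrite (bigID [pred d | d \in b |: (c |: B)]) /= big1 ?add0r.
    by apply: eq_bigl => d; rewrite !inE; case: eqP; rewrite ?andbF ?orbT.
  by move=> d /andP[db]; rewrite !inE (negPf db) /= => dB; rewrite f0 // !inE.
have cb1 := cardU2 cardB bB; have cc1 := cardU2 cardB cB.
rewrite /cond_mean split_b; last by move=> d dB; rewrite tr_in // mul0r.
rewrite split_c; last by move=> d dB; rewrite tr_in // mul0r.
have Sb := sum_tr cb1; rewrite split_b in Sb; last by move=> d dB; rewrite tr_in.
have Sc := sum_tr cc1; rewrite split_c in Sc; last by move=> d dB; rewrite tr_in.
have -> : b |: (c |: B) = c |: (b |: B) by rewrite finset.setUCA.
set Wbc := h (c |: (b |: B)).
set S := [pred d | d \notin c |: (b |: B)].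
have -> : \sum_(d | d \notin c |: (b |: B))
    (tr (b |: B) d * (h (d |: (b |: B)) - r * h (d |: (c |: B)))
     + r * ((tr (b |: B) d - tr (c |: B) d) * (h (d |: (c |: B)) - Wbc))) =
   \sum_(d | S d) tr (b |: B) d * h (d |: (b |: B))
   - r * (\sum_(d | S d) tr (c |: B) d * h (d |: (c |: B)))
   - r * Wbc * (\sum_(d | S d) tr (b |: B) d - \sum_(d | S d) tr (c |: B) d).
  rewrite -!sumrB !mulr_sumr -!sumrB; apply: eq_bigr => d _; ring.
have -> : \sum_(d | S d) tr (b |: B) d = 1 - tr (b |: B) c.
  by rewrite -Sb finset.setUCA addrAC subrr add0r.
have -> : \sum_(d | S d) tr (c |: B) d = 1 - tr (c |: B) b.
  by rewrite -Sc finset.setUCA addrAC subrr add0r.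
rewrite -/Wbc; ring.
Qed.

Let card_rest b c : b \notin B -> c \notin B -> c != b ->
  #|[pred d | d \notin b |: (c |: B)]| = m.
Proof.
move=> bB cB cb.
have -> : #|[pred d | d \notin b |: (c |: B)]| = #|~: (b |: (c |: B))|.
  by apply: eq_card => d; rewrite !inE.
rewrite cardsCs finset.setCK !cardsU1 cB cardB !inE negb_or eq_sym cb bB /m.
by rewrite /= !add1n -n_pred subn1 prednK // (leq_trans _ n_ge2).
Qed.

Lemma cond_mean_log_lipschitz h r b c : 1 <= r -> pos_on h -> log_lipschitz r h ->
  b \notin B -> c \notin B -> c != b ->
  E_ h (b |: B) - r * E_ h (c |: B) <=
    r * (r - 1) * (m%:R * r2 n mu) * h (c |: (b |: B)).
Proof.
move=> r1' hp hl bB cB cb; rewrite cond_mean_sub //.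
have cb1 := cardU2 cardB bB; have cc1 := cardU2 cardB cB.
have cbB : c \notin b |: B by rewrite !inE negb_or cb.
have bcB : b \notin c |: B by rewrite !inE negb_or eq_sym cb.
set Wbc := h (c |: (b |: B)).
have W0 : 0 < Wbc by apply: hp; exact: cardU.
have last0 : 0 <= (r - 1) * (tr (b |: B) c * Wbc).
  by rewrite mulr_ge0 ?subr_ge0 // mulr_ge0 // ltW.
rewrite lerBlDr; apply: le_trans (_ : _ <= r * (r - 1) * (m%:R * r2 n mu) * Wbc) _; last by rewrite lerDl.
have -> : r * (r - 1) * (m%:R * r2 n mu) * Wbc =
   \sum_(d | d \notin b |: (c |: B)) r * (r2 n mu * ((r - 1) * Wbc)).
  rewrite sumr_const card_rest // -[RHS]mulr_natl; ring.
apply: ler_sum => d; rewrite !inE !negb_or => /and3P[db dc dB].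
have dbB : d \notin b |: B by rewrite !inE negb_or db.
have dcB : d \notin c |: B by rewrite !inE negb_or dc.
have r0 : 0 <= r by apply: le_trans r1'; exact: ler01.
have H1 : h (d |: (b |: B)) - r * h (d |: (c |: B)) <= 0.
  rewrite subr_le0 finset.setUCA (finset.setUCA [set d] [set c]); apply: hl.
  - exact: cardU2.
  - by rewrite !inE negb_or eq_sym db.
  - by rewrite !inE negb_or eq_sym dc.
have H2 : `|h (d |: (c |: B)) - Wbc| <= (r - 1) * Wbc.
  have A1 : h (d |: (c |: B)) <= r * Wbc by rewrite /Wbc (finset.setUCA [set c]); exact: hl.
  have A2 : Wbc <= r * h (d |: (c |: B)) by rewrite /Wbc (finset.setUCA [set c]); exact: hl.
  rewrite ler_norml; apply/andP; split; last by lra.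
  move: {last0} r1' A1 A2 W0; move: (h (d |: _)) Wbc => x y; nra.
have H3 := tr_infl cardB bB cB dB cb db dc.
rewrite -[leRHS]add0r; apply: lerD.
  by rewrite mulr_ge0_le0.
apply: ler_wpM2l => //; apply: le_trans (ler_norm _) _; rewrite normrM.
exact: ler_pM.
Qed.

Lemma cond_mean_lipschitz h (L : R) b c : 0 <= L -> lipschitz L h ->
  b \notin B -> c \notin B -> c != b ->
  `|E_ h (b |: B) - E_ h (c |: B)| <= (1 + m%:R * r2 n mu) * L.
Proof.
move=> L0 hl bB cB cb.
have cb1 := cardU2 cardB bB; have cc1 := cardU2 cardB cB.
have cbB : c \notin b |: B by rewrite !inE negb_or cb.
have := cond_mean_sub h 1 bB cB cb; rewrite subrr !mul0r subr0 mul1r => ->.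
apply: le_trans (ler_norm_sum _ _ _) _.
apply: (@le_trans _ _ (\sum_(d | d \notin b |: (c |: B)) (tr (b |: B) d * L + r2 n mu * L))).
  apply: ler_sum => d; rewrite !inE !negb_or => /and3P[db dc dB]; rewrite !mul1r.
  have dbB : d \notin b |: B by rewrite !inE negb_or db.
  have dcB : d \notin c |: B by rewrite !inE negb_or dc.
  apply: le_trans (ler_normD _ _) _; rewrite (normrM (tr _ _)) (normrM (tr _ _ - _)); apply: lerD.
    rewrite (ger0_norm (tr_ge0 _ _)) ler_wpM2l // finset.setUCA (finset.setUCA [set d] [set c]).
    apply: hl; first exact: cardU2.
      by rewrite !inE negb_or eq_sym db.
    by rewrite !inE negb_or eq_sym dc.
  apply: ler_pM => //; first exact: tr_infl.
  rewrite (finset.setUCA [set c]); apply: hl => //.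
  by rewrite !inE negb_or eq_sym cb.
rewrite big_split /= sumr_const card_rest // -mulr_suml mulrDl mul1r.
apply: lerD; last by rewrite -[leLHS]mulr_natl mulrA.
rewrite -[leRHS]mul1r ler_wpM2r // -(sum_tr cb1).
rewrite [leRHS](bigID [pred d | d \notin b |: (c |: B)]) /= lerDl.
exact: sumr_ge0.
Qed.

(** Two exchanges of one point lead from B with b, d to B with b, c and then to B with c, d'; each
    costs a factor r. *)
Lemma cond_mean_comparable h r b c : 1 <= r -> pos_on h -> log_lipschitz r h ->
  b \notin B -> c \notin B -> E_ h (b |: B) <= r ^+ 2 * E_ h (c |: B).
Proof.
move=> r1' hp hl bB cB.
have r0 : 0 < r by apply: lt_le_trans r1'; exact: ltr01.
have cb1 := cardU2 cardB bB; have cc1 := cardU2 cardB cB.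
apply: mean_le => // d dbB.
rewrite mulrC -ler_pdivrMr ?exprn_gt0 //; apply: mean_ge => // d' dcB.
rewrite ler_pdivrMr ?exprn_gt0 // mulrC expr2 -mulrA.
have [E|cb] := eqVneq c b.
  rewrite E in dcB *; apply: le_trans (hl _ cb1 _ _ dbB dcB) _.
  apply: ler_wpM2l; first exact: ltW.
  by apply: ler_peMl => //; rewrite ltW // hp // cardU.
have cbB : c \notin b |: B by rewrite !inE negb_or cb.
apply: le_trans (hl _ cb1 _ _ dbB cbB) _; rewrite ler_wpM2l ?(ltW r0) //.
by rewrite finset.setUCA; apply: hl => //; rewrite !inE negb_or eq_sym cb.
Qed.

End Link.

(** The common term leaves a slack (r - 1) E_ h B. Each of the n - 1 other removals exceeds its
    share by at most r^3 (r - 1) m r2 E_ h B, in total at most r^3 rho (r - 1) E_ h B. *)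
Lemma resample_log_lipschitz r h : 1 <= r -> r ^+ 3 * rho <= 1 ->
  pos_on h -> log_lipschitz r h -> log_lipschitz r (P h).
Proof.
move=> r1' r3 hp hl B cB b c bB cB'.
have r0 : 0 < r by apply: lt_le_trans r1'; exact: ltr01.
have [->|cb] := eqVneq b c.
  by apply: ler_peMl => //; rewrite ltW // resample_gt0 // cardU.
rewrite eq_sym in cb.
rewrite !resampleU // mulrCA ler_wpM2l ?invr_ge0 ?(ltW n_gt0) //.
rewrite mulrDr [r * \sum_(e in B) _]mulr_sumr -subr_ge0.
have EB0 := mean_gt0 cB hp.
have Hs : \sum_(e in B) (E_ h (b |: (B :\ e)) - r * E_ h (c |: (B :\ e))) <=
   \sum_(e in B) r * (r - 1) * (m%:R * r2 n mu) * (r ^+ 2 * E_ h B).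
  apply: ler_sum => e eB; have cBe := cardD cB eB.
  have bBe : b \notin B :\ e by rewrite !inE (negPf bB) andbF.
  have cBe' : c \notin B :\ e by rewrite !inE (negPf cB') andbF.
  apply: le_trans (cond_mean_log_lipschitz cBe r1' hp hl bBe cBe' cb) _.
  apply: ler_wpM2l.
    by rewrite !mulr_ge0 ?subr_ge0 // ltW.
  rewrite mulrC -ler_pdivrMr ?exprn_gt0 //; apply: mean_ge => // d dB.
  rewrite ler_pdivrMr ?exprn_gt0 // mulrC expr2 -mulrA.
  have eb : e != b by apply: contraNneq bB => <-.
  apply: le_trans (_ : _ <= r * h (e |: (b |: (B :\ e)))) _.
    apply: hl; first exact: cardU2.
      by rewrite !inE (negPf cB') andbF orbF.
    by rewrite !inE eqxx orbF.
  by rewrite ler_wpM2l ?(ltW r0) // finset.setUCA finset.setD1K //; exact: hl.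
rewrite sumrB in Hs; rewrite sumr_const cB in Hs.
have Hn : (r * (r - 1) * (m%:R * r2 n mu) * (r ^+ 2 * E_ h B)) *+ (n - 1)
   <= (r - 1) * E_ h B.
  rewrite -[leLHS]mulr_natl natrB ?(leq_trans _ n_ge2) //.
  have -> : (n%:R - 1) * (r * (r - 1) * (m%:R * r2 n mu) * (r ^+ 2 * E_ h B)) =
     ((n%:R - 1) * (m%:R * r2 n mu) * r ^+ 3) * ((r - 1) * E_ h B) by ring.
  rewrite -[leRHS]mul1r ler_wpM2r ?mulr_ge0 ?subr_ge0 ?(ltW EB0) //.
  apply: le_trans r3; rewrite mulrC ler_wpM2l ?exprn_ge0 ?(ltW r0) //.
  rewrite /rho /inhomogeneity -/m mulrDr mulrBl mul1r.
  have : 0 <= n%:R * r1 n mu by rewrite mulr_ge0 // ltW.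
  have : 0 <= m%:R * r2 n mu by rewrite mulr_ge0.
  lra.
have := le_trans Hs Hn; lra.
Qed.

(** Path coupling: removing the point that differs makes the two sets agree, while each of the n - 1
    other removals expands distances by at most 1 + m r2; and (n - 1)(1 + m r2) <= n - tau. *)
Lemma resample_lipschitz (L : R) h : 0 <= L -> lipschitz L h ->
  lipschitz ((1 - tau / n%:R) * L) (P h).
Proof.
move=> L0 hl B cB b c bB cB'.
have tau_le : (n%:R - 1) * (1 + m%:R * r2 n mu) <= n%:R - tau.
  rewrite /tau /rho /inhomogeneity -/m.
  have : 0 <= n%:R * r1 n mu by rewrite mulr_ge0 // ltW.
  have : 0 <= m%:R * r2 n mu by rewrite mulr_ge0.
  lra.
have n1 : 0 <= n%:R - 1 :> R by rewrite subr_ge0 ler1n (leq_trans _ n_ge2).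
have [->|cb] := eqVneq b c.
  rewrite subrr normr0 mulr_ge0 // subr_ge0 ler_pdivrMr // mul1r.
  have : 0 <= (n%:R - 1) * (1 + m%:R * r2 n mu).
    by rewrite mulr_ge0 // addr_ge0 // mulr_ge0.
  lra.
rewrite eq_sym in cb; rewrite !resampleU // -mulrBr opprD addrACA subrr add0r -sumrB.
rewrite normrM ger0_norm ?invr_ge0 ?(ltW n_gt0) //.
rewrite mulrC ler_pdivrMr //; apply: le_trans (ler_norm_sum _ _ _) _.
apply: (@le_trans _ _ (\sum_(e in B) (1 + m%:R * r2 n mu) * L)).
  apply: ler_sum => e eB; apply: cond_mean_lipschitz => //; first exact: cardD.
    by rewrite !inE (negPf bB) andbF.
  by rewrite !inE (negPf cB') andbF.
rewrite sumr_const cB -[leLHS]mulr_natl natrB ?(leq_trans _ n_ge2) // mulrA.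
have -> : (1 - tau / n%:R) * L * n%:R = (n%:R - tau) * L by field; rewrite gt_eqF.
by rewrite ler_wpM2r.
Qed.

Definition chi2 h := \sum_(B : {set T} | #|B| == (n - 1)%N)
  \sum_b mu (b |: B) * ((h (b |: B) - E_ h B) ^+ 2 / h (b |: B)).

Let nlam : n%:R * lam = rho. Proof. by []. Qed.

Let lam_ge0 : 0 <= lam. Proof. by rewrite addr_ge0 // mulr_ge0. Qed.

Let lam_lt1 : lam < 1.
Proof.
rewrite -(ltr_pM2l n_gt0) mulr1 nlam; apply: lt_le_trans rho_lt1 _.
by apply: le_trans n_ge2R; rewrite ler1n.
Qed.

Let mu_small X : (#|X| <= n - 1)%N -> mu X = 0.
Proof.
move=> cX; apply: mu0; rewrite neq_ltn; apply/orP; left.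
by apply: leq_ltn_trans cX _; rewrite subn1 ltn_predL (leq_trans _ n_ge2).
Qed.

(** [two_point_contraction] for the pairs of points outside B; the rest is the verification that
    pairs which coincide or meet B carry no mass. *)
Lemma link_contraction B h r : #|B| = (n - 2)%N ->
  1 <= r -> pos_on h -> log_lipschitz r h ->
  \sum_(e | e \notin B) \sum_b mu (b |: (e |: B)) *
     ((E_ h (b |: B) - \sum_c tr (e |: B) c * E_ h (c |: B)) ^+ 2 / E_ h (b |: B)) <=
  (1 + 2 * r ^+ 2 * (lam / (1 - lam)) + 4 * lam * (r ^+ 2 - 1)) *
  \sum_(d | d \notin B) \sum_b mu (b |: (d |: B)) *
     ((h (b |: (d |: B)) - E_ h (d |: B)) ^+ 2 / h (b |: (d |: B))).
Proof.
move=> cB r1' hp hl.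
pose w x y := mu (y |: (x |: B)); pose W x y := h (y |: (x |: B)).
have c1 x y : (#|y |: (x |: B)| <= (y \notin x |: B) + ((x \notin B) + (n - 2)))%N.
  by rewrite !cardsU1 cB.
have w_sym x y : w x y = w y x by rewrite /w finset.setUCA.
have w_diag x : w x x = 0.
  apply: mu_small; apply: leq_trans (c1 x x) _.
  by rewrite !inE eqxx /= n_pred add0n; exact: leq_add (leq_b1 _) (leqnn _).
have w_out x y : x \notin ~: B -> w x y = 0.
  rewrite inE negbK => xB; apply: mu_small; apply: leq_trans (c1 x y) _.
  by rewrite xB add0n n_pred; exact: leq_add (leq_b1 _) (leqnn _).
have inD x : (x \in ~: B) = (x \notin B) by rewrite inE.
have massw x : x \in ~: B -> \sum_y w x y = extension_mass mu (x |: B).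
  by rewrite inD => xB; rewrite massE // cardU2.
have Qw x y : x \in ~: B -> w x y / (\sum_y0 w x y0) = tr (x |: B) y.
  by move=> xB; rewrite massw.
have Fw x : x \in ~: B -> \sum_y w x y / (\sum_y0 w x y0) * W x y = E_ h (x |: B).
  by move=> xB; apply: eq_bigr => y _; rewrite Qw.
have cardD' : #|~: B| = m.+2.
  by rewrite cardsCs finset.setCK cB /m subnBA // -addnBAC // addn2.
have r0 : 0 < r by apply: lt_le_trans r1'; exact: ltr01.
have deg_gt0 x : x \in ~: B -> 0 < \sum_y w x y.
  by move=> xB; rewrite massw // mu_pos // cardU2 // -inD.
have Q_le x y : x \in ~: B -> y \in ~: B -> x != y ->
    w x y / (\sum_y0 w x y0) <= r1 n mu.
  move=> xB yB xy; rewrite Qw //; rewrite !inD in xB yB.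
  by rewrite tr_le ?cardU2 // !inE negb_or yB eq_sym xy.
have Q_infl x c y : x \in ~: B -> c \in ~: B -> y \in ~: B -> x != c -> y != x ->
    y != c -> `|w x y / (\sum_y0 w x y0) - w c y / (\sum_y0 w c y0)| <= r2 n mu.
  move=> xB cB' yB xc yx yc; rewrite !Qw //; rewrite !inD in xB cB' yB.
  by apply: tr_infl => //; rewrite eq_sym.
have rr1 : 1 <= r ^+ 2 by rewrite exprn_ege1.
have W_gt0 x y : x \in ~: B -> y \in ~: B -> x != y -> 0 < W x y.
  rewrite !inD => xB yB xy; apply: hp; apply: cardU; first exact: cardU2.
  by rewrite !inE negb_or eq_sym xy.
have F_le x y : x \in ~: B -> y \in ~: B ->
    \sum_z w x z / (\sum_y0 w x y0) * W x z <=
    r ^+ 2 * (\sum_z w y z / (\sum_y0 w y y0) * W y z).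
  by move=> xB yB; rewrite !Fw //; rewrite !inD in xB yB; exact: cond_mean_comparable.
have := @two_point_contraction R T (~: B) w (fun x y => mu_ge0 _) w_sym w_diag w_out
  deg_gt0 (r1 n mu) (r2 n mu) m r2_ge0 cardD' Q_le Q_infl W (r ^+ 2) rr1 W_gt0 F_le lam_lt1.
rewrite -/lam => H.
apply: le_trans (le_trans H _).
  rewrite [leRHS](bigID [pred e | e \notin B]) /= [X in _ <= _ + X]big1 ?addr0; last first.
    move=> e eB; rewrite big1 // => b _; rewrite w_out ?mul0r //.
    by rewrite inE negbK; rewrite negbK in eB.
  apply: ler_sum => e eB; apply: ler_sum => b _.
  have [bB|bB] := boolP (b \in B).
    have -> : mu (b |: (e |: B)) = 0 by rewrite finset.setUCA; apply: w_out; rewrite inE negbK.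
    by rewrite mul0r w_sym w_out ?mul0r // inE negbK.
  rewrite Fw ?inD // le_eqVlt; apply/orP; left; apply/eqP.
  congr (_ * ((_ - _) ^+ 2 / _)).
  apply: eq_bigr => c _; rewrite Qw ?inD //.
  have [cB'|cB'] := boolP (c \in B); last by rewrite Fw ?inD.
  by rewrite tr_in ?mul0r ?cardU2 // !inE cB' orbT.
apply: ler_wpM2l.
  rewrite addr_ge0 //; last by rewrite mulr_ge0 ?subr_ge0 // mulr_ge0.
  apply: addr_ge0 => //; apply: mulr_ge0; last by rewrite divr_ge0 // subr_ge0 ltW.
  by rewrite mulr_ge0 // exprn_ge0 // ltW.
rewrite exchange_big [leLHS](bigID [pred e | e \notin B]) /= [X in _ + X]big1 ?addr0; last first.
  move=> e eB; rewrite big1 // => b _; rewrite w_sym w_out ?mul0r //.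
  by rewrite inE negbK; rewrite negbK in eB.
apply: ler_sum => e eB; apply: ler_sum => b _.
by rewrite Fw ?inD // /w /W !(finset.setUCA [set e]) // finset.setUCA.
Qed.
Let rho_ge0 : 0 <= rho. Proof. by rewrite -nlam mulr_ge0 // ltW. Qed.

Let cond_mean_resample h B : #|B| = (n - 1)%N ->
  E_ (P h) B = n%:R^-1 * (E_ h B + \sum_(e in B) \sum_c tr B c * E_ h (c |: (B :\ e))).
Proof.
move=> cB; rewrite {1}/cond_mean exchange_big /=.
transitivity (\sum_c tr B c * (n%:R^-1 * (E_ h B + \sum_(e in B) E_ h (c |: (B :\ e))))).
  apply: eq_bigr => c _; have [cB'|cB'] := boolP (c \in B); first by rewrite tr_in // !mul0r.
  by rewrite resampleU.
rewrite -[E_ h B in RHS]mul1r -(sum_tr cB) mulr_suml -big_split /= mulr_sumr.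
by apply: eq_bigr => c _; rewrite mulrCA mulrDr [_ * \sum_(e in B) _]mulr_sumr.
Qed.

(** Over a fixed B the fluctuation of P h is 1 / n times the sum over e in B of fluctuations [G e]
    on the links of B :\ e. Cauchy-Schwarz over e, with the common mean [E_ h B] kept in the
    denominator, yields the factor theta < 1. Regrouping by links and then by (n-1)-sets counts each
    of the latter n - 1 times. *)
Lemma chi2_resample_le h r : 1 <= r -> pos_on h -> log_lipschitz r h ->
  chi2 (P h) <= n%:R^-1 * ((n%:R - 1) * r ^+ 2 / ((n%:R - 1) * r ^+ 2 + 1)) *
    (1 + 2 * r ^+ 2 * (lam / (1 - lam)) + 4 * lam * (r ^+ 2 - 1)) * (n%:R - 1) * chi2 h.
Proof.
move=> r1' hp hl.
have r0 : 0 < r by apply: lt_le_trans r1'; exact: ltr01.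
have rr0 : 0 < r ^+ 2 by rewrite exprn_gt0.
have N1 : 0 < n%:R - 1 :> R by rewrite subr_gt0 ltr1n.
have nE : (n - 1)%:R = n%:R - 1 :> R by rewrite natrB // (leq_trans _ n_ge2).
have cn0 : (0 < n - 1)%N by rewrite n_pred.
have cn2 : ((n - 1).-1 = n - 2)%N by rewrite n_pred.
set theta := _ / (_ + 1); set Lam := 1 + _ + _.
have a0 : 0 <= (n%:R - 1) * r ^+ 2 by rewrite mulr_ge0 // ltW.
have theta0 : 0 <= theta by rewrite divr_ge0 // addr_ge0.
pose H B e := \sum_b mu (b |: (e |: B)) *
     ((E_ h (b |: B) - \sum_c tr (e |: B) c * E_ h (c |: B)) ^+ 2 / E_ h (b |: B)).
pose K B := \sum_b mu (b |: B) * ((h (b |: B) - E_ h B) ^+ 2 / h (b |: B)).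
have step : chi2 (P h) <= n%:R^-1 * theta *
    \sum_(B : {set T} | #|B| == (n - 1)%N) \sum_(e in B) H (B :\ e) e.
  rewrite mulr_sumr; apply: ler_sum => B /eqP cB.
  rewrite /H exchange_big /= mulr_sumr; apply: ler_sum => b _.
  have [bB|bB] := boolP (b \in B).
    rewrite mu_in // mul0r big1 ?mulr0 // => e eB.
    by rewrite finset.setD1K // mu_in // mul0r.
  pose G e := E_ h (b |: (B :\ e)) - \sum_c tr B c * E_ h (c |: (B :\ e)).
  pose F e := E_ h (b |: (B :\ e)).
  have bBe e : b \notin B :\ e by rewrite !inE (negPf bB) andbF.
  have F0 e : e \in B -> 0 < F e.
    by move=> eB; apply: mean_gt0 => //; apply: cardU2 => //; exact: cardD.
  have EB0 := mean_gt0 cB hp.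
  have S0 : 0 < \sum_(e in B) F e.
    have : (0 < #|B|)%N by rewrite cB.
    case/card_gt0P => e eB; rewrite (bigD1 e) //= ltr_pwDl ?F0 //.
    by apply: sumr_ge0 => f /andP[fB _]; rewrite ltW // F0.
  have -> : \sum_(e in B) mu (b |: (e |: B :\ e)) *
      ((E_ h (b |: B :\ e) - \sum_c tr (e |: B :\ e) c * E_ h (c |: B :\ e)) ^+ 2 /
        E_ h (b |: B :\ e)) = mu (b |: B) * \sum_(e in B) 1 * (G e ^+ 2 / F e).
    by rewrite mulr_sumr; apply: eq_bigr => e eB; rewrite finset.setD1K // mul1r.
  rewrite [leRHS]mulrCA; apply: ler_wpM2l => //.
  have CS : (\sum_(e in B) G e) ^+ 2 / (\sum_(e in B) F e) <=
      \sum_(e in B) 1 * (G e ^+ 2 / F e).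
    have := @sum_sqr_div_le R T (mem B) (fun=> 1) G F.
    have E f : \sum_(e in B) 1 * f e = \sum_(e in B) f e :> R.
      by apply: eq_bigr => e _; rewrite mul1r.
    by rewrite (E F) (E G); apply => // e eB _; exact: F0.
  rewrite cond_mean_resample // resampleU // -mulrBr opprD addrACA subrr add0r -sumrB.
  rewrite -/(F _).
  have -> : (n%:R^-1 * \sum_(e in B) G e) ^+ 2 / (n%:R^-1 * (E_ h B + \sum_(e in B) F e)) =
    n%:R^-1 * ((\sum_(e in B) F e) / (E_ h B + \sum_(e in B) F e)) *
       ((\sum_(e in B) G e) ^+ 2 / (\sum_(e in B) F e)).
    move: S0 EB0 n_gt0; move: (\sum_(e in B) G e) (\sum_(e in B) F e) (E_ h B) n%:R.
    move=> g s x N s0 x0 N0; field; rewrite !gt_eqF // addr_gt0 //.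
  apply: ler_pM => //.
  - by rewrite mulr_ge0 ?invr_ge0 ?(ltW n_gt0) // divr_ge0 ?addr_ge0 ?(ltW S0) ?(ltW EB0).
  - by rewrite divr_ge0 ?sqr_ge0 ?(ltW S0).
  rewrite ler_wpM2l ?invr_ge0 ?(ltW n_gt0) //.
  (* Each [F e] is at most r^2 E_ h B, so their sum takes at most the share theta of the
     denominator. *)
  have SE : \sum_(e in B) F e <= (n%:R - 1) * r ^+ 2 * E_ h B.
    rewrite -nE -cB -mulrA mulr_natl -sumr_const; apply: ler_sum => e eB.
    rewrite /F -{2}(finset.setD1K eB); apply: cond_mean_comparable => //; first exact: cardD.
    by rewrite !inE eqxx.
  rewrite ler_pdivrMr ?addr_gt0 // /theta mulrAC ler_pdivlMr ?addr_gt0 ?mulr_gt0 //.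
  move: SE; move: (\sum_(e in B) F e) (E_ h B) ((n%:R - 1) * r ^+ 2) => s x y; lra.
apply: le_trans step _.
rewrite -!(mulrA (n%:R^-1 * theta)); apply: ler_wpM2l.
  by rewrite mulr_ge0 // invr_ge0 ltW.
rewrite (sum_setD1_card H) // cn2.
apply: (@le_trans _ _ (\sum_(B : {set T} | #|B| == (n - 2)%N)
    Lam * \sum_(d | d \notin B) K (d |: B))).
  by apply: ler_sum => B /eqP cB; exact: link_contraction.
rewrite -mulr_sumr -mulrA; apply: ler_wpM2l.
  have lam1 : 0 <= lam / (1 - lam) by rewrite divr_ge0 // subr_ge0 ltW.
  have : 0 <= r ^+ 2 * (lam / (1 - lam)) by rewrite mulr_ge0 // ltW.
  have : 0 <= lam * (r ^+ 2 - 1) by rewrite mulr_ge0 // subr_ge0 exprn_ege1.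
  rewrite /Lam; lra.
rewrite -cn2 -(sum_setD1_card (fun B d => K (d |: B))) // /chi2 mulr_sumr.
apply: ler_sum => B /eqP cB.
rewrite (eq_bigr (fun=> K B)); last by move=> e eB; rewrite finset.setD1K.
by rewrite sumr_const cB -nE mulr_natl.
Qed.

Lemma chi2_resample_contraction h r : 1 <= r -> r ^+ 2 - 1 <= tau / 24 ->
  pos_on h -> log_lipschitz r h ->
  chi2 (P h) <= (1 - tau / (2 * n%:R)) * chi2 h.
Proof.
move=> r1' rtau hp hl; apply: le_trans (chi2_resample_le r1' hp hl) _.
have chi0 : 0 <= chi2 h.
  apply: sumr_ge0 => B /eqP cB; apply: sumr_ge0 => b _.
  have [bB|bB] := boolP (b \in B); first by rewrite mu_in // mul0r.
  by rewrite mulr_ge0 // divr_ge0 ?sqr_ge0 // ltW // hp // cardU.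
apply: ler_wpM2r => //.
have -> : lam = rho / n%:R by rewrite -nlam mulrAC mulfV ?mul1r // gt_eqF.
by apply: contraction_factor_le => //; rewrite exprn_ege1.
Qed.

(** * Expectations along the chain *)

Let Ex (g : {set T} -> R) := \sum_X mu X * g X.

Lemma sum_removals (G : {set T} -> T -> R) :
  \sum_X mu X * \sum_(e in X) G (X :\ e) e =
  \sum_(B : {set T} | #|B| == (n - 1)%N) \sum_b mu (b |: B) * G B b.
Proof.
have := sum_setD1_card (fun B e => mu (e |: B) * G B e) (leq_trans (isT : 0 < 2)%N n_ge2).
rewrite -subn1 => E; transitivity (\sum_(X : {set T} | #|X| == n) \sum_(e in X)
    mu (e |: X :\ e) * G (X :\ e) e).
  rewrite [RHS]big_mkcond; apply: eq_bigr => X _; case: eqP => [cX|/eqP cX].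
    by rewrite mulr_sumr; apply: eq_bigr => e eX; rewrite finset.setD1K.
  by rewrite mu0 // mul0r.
rewrite E; apply: eq_bigr => B /eqP cB.
rewrite [RHS](bigID [pred b | b \notin B]) /= [X in _ + X]big1 ?addr0 // => b.
by rewrite negbK => bB; rewrite mu_in // mul0r.
Qed.

Lemma expectation_sub_resample phi h :
  Ex (fun X => phi X * h X) - Ex (fun X => phi X * P h X) = n%:R^-1 *
  \sum_(B : {set T} | #|B| == (n - 1)%N)
    \sum_b mu (b |: B) * (phi (b |: B) * (h (b |: B) - E_ h B)).
Proof.
have E0 (a : {set T} -> R) : Ex (fun X => phi X * (h X - P h X)) =
    n%:R^-1 * \sum_X mu X * \sum_(e in X) (phi (e |: (X :\ e)) * (h (e |: (X :\ e)) - E_ h (X :\ e))).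
  rewrite mulr_sumr; apply: eq_bigr => X _; rewrite [RHS]mulrCA.
  have [cX|cX] := eqVneq #|X| n; last by rewrite mu0 // !mul0r.
  congr (_ * _).
  rewrite (eq_bigr (fun e => phi X * h X - phi X * E_ h (X :\ e))); last first.
    by move=> e eX; rewrite finset.setD1K // mulrBr.
  rewrite sumrB sumr_const cX -mulr_sumr /resample -[phi X * h X *+ n]mulr_natl.
  by field; rewrite gt_eqF.
rewrite -(sum_removals (fun B b => phi (b |: B) * (h (b |: B) - E_ h B))) -E0 //.
by rewrite /Ex -sumrB; apply: eq_bigr => X _; ring.
Qed.

Let sum_centered h B : #|B| = (n - 1)%N ->
  \sum_b mu (b |: B) * (h (b |: B) - E_ h B) = 0.
Proof.
move=> cB; under eq_bigr => b _ do rewrite mulrBr.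
rewrite sumrB -mulr_suml -massE //.
apply/eqP; rewrite subr_eq0; apply/eqP; rewrite /cond_mean mulr_sumr.
by apply: eq_bigr => b _; rewrite mulrA -mu_tr.
Qed.

Lemma expectation_resample h : Ex (P h) = Ex h.
Proof.
have := expectation_sub_resample (fun=> 1) h.
rewrite big1 => [|B /eqP cB]; last first.
  by rewrite -[RHS](sum_centered h cB); apply: eq_bigr => b _; rewrite mul1r.
rewrite mulr0 => /eqP; rewrite subr_eq0 => /eqP E.
by rewrite /Ex in E *; under eq_bigr do rewrite -[P h _]mul1r; rewrite -E; apply: eq_bigr => X _; rewrite mul1r.
Qed.

Section Observable.
Variables (phi : {set T} -> R) (K : R).
Hypothesis efron_stein : forall X, #|X| = n ->
  \sum_(b in X) (phi X - phi (X :\ b)) ^+ 2 <= K.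

Let ES_le h : pos_on h ->
  \sum_(B : {set T} | #|B| == (n - 1)%N)
    \sum_b mu (b |: B) * (h (b |: B) * (phi (b |: B) - phi B) ^+ 2) <= K * Ex h.
Proof.
move=> hp; rewrite -(sum_removals (fun B b => h (b |: B) * (phi (b |: B) - phi B) ^+ 2)).
rewrite mulr_sumr; apply: ler_sum => X _.
have [cX|cX] := eqVneq #|X| n; last by rewrite mu0 // !mul0r mulr0.
rewrite mulrCA ler_wpM2l // (eq_bigr (fun b => h X * (phi X - phi (X :\ b)) ^+ 2)).
  by rewrite -mulr_sumr mulrC ler_wpM2r ?efron_stein // ltW // hp.
by move=> e eX; rewrite finset.setD1K.
Qed.

(** Since h - E_ h B is centred over B, [phi (b |: B)] can be replaced by its increment over
    [phi B]. The AM-GM inequality with weight s h then separates the squared increments of [phi]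
    from [chi2 h]; s stays free in order to follow the decay of [chi2]. *)
Lemma expectation_step_le h s : pos_on h -> 0 < s ->
  `|Ex (fun X => phi X * h X) - Ex (fun X => phi X * P h X)| <=
  (2 * n%:R)^-1 * (s * (K * Ex h) + s^-1 * chi2 h).
Proof.
move=> hp s0; rewrite expectation_sub_resample normrM ger0_norm ?invr_ge0 ?(ltW n_gt0) //.
rewrite invfM (mulrC 2^-1) -mulrA (mulrC 2^-1); apply: ler_wpM2l; first by rewrite invr_ge0 ltW.
have -> : \sum_(B : {set T} | #|B| == (n - 1)%N)
    \sum_b mu (b |: B) * (phi (b |: B) * (h (b |: B) - E_ h B)) =
  \sum_(B : {set T} | #|B| == (n - 1)%N)
    \sum_b mu (b |: B) * ((phi (b |: B) - phi B) * (h (b |: B) - E_ h B)).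
  apply: eq_bigr => B /eqP cB; apply/eqP; rewrite -subr_eq0 -sumrB; apply/eqP.
  transitivity (phi B * \sum_b mu (b |: B) * (h (b |: B) - E_ h B)).
    by rewrite mulr_sumr; apply: eq_bigr => b _; ring.
  by rewrite sum_centered // mulr0.
apply: le_trans (ler_norm_sum _ _ _) _.
apply: (@le_trans _ _ ((s * (\sum_(B : {set T} | #|B| == (n - 1)%N)
    \sum_b mu (b |: B) * (h (b |: B) * (phi (b |: B) - phi B) ^+ 2)) + s^-1 * chi2 h) * 2^-1)); last first.
  rewrite ler_wpM2r ?invr_ge0 // lerD2r ler_wpM2l ?(ltW s0) //; exact: ES_le.
rewrite !mulr_sumr -big_split mulr_suml /=; apply: ler_sum => B /eqP cB.
apply: le_trans (ler_norm_sum _ _ _) _.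
rewrite !mulr_sumr -big_split mulr_suml /=; apply: ler_sum => b _.
have [bB|bB] := boolP (b \in B).
  by rewrite mu_in // !mul0r normr0 !mulr0 addr0 mul0r.
have h0 : 0 < h (b |: B) by rewrite hp // cardU.
rewrite normrM ger0_norm //.
have -> : (s * (mu (b |: B) * (h (b |: B) * (phi (b |: B) - phi B) ^+ 2)) +
   s^-1 * (mu (b |: B) * ((h (b |: B) - E_ h B) ^+ 2 / h (b |: B)))) * 2^-1 =
  mu (b |: B) * ((s * h (b |: B) * (phi (b |: B) - phi B) ^+ 2 +
    (s * h (b |: B))^-1 * (h (b |: B) - E_ h B) ^+ 2) * 2^-1).
  by rewrite invfM; ring.
apply: ler_wpM2l => //; rewrite normrM.
have c0 : 0 < s * h (b |: B) by rewrite mulr_gt0.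
rewrite -(real_normK (num_real (phi (b |: B) - phi B))).
rewrite -(real_normK (num_real (h (b |: B) - E_ h B))).
move: c0; move: (s * _) `|phi _ - _| `|h _ - _| => c x y c0.
rewrite -subr_ge0.
have -> : (c * x ^+ 2 + c^-1 * y ^+ 2) * 2^-1 - x * y = c^-1 * 2^-1 * (c * x - y) ^+ 2.
  by field; rewrite gt_eqF.
by rewrite mulr_ge0 ?sqr_ge0 // mulr_ge0 ?invr_ge0 // ltW.
Qed.

(** A conditional variance is at most the second moment about h B. For increments of l phi below
    1/10, [h] and e^x - 1 are distorted by factors at most 10/9, and the fourth power of 10/9 is
    below 2. *)
Lemma chi2_expR_le (l a : R) : 0 < a ->
  (forall B b, #|B| = (n - 1)%N -> b \notin B -> `|l * (phi (b |: B) - phi B)| <= 10^-1) ->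
  let h := fun X => a * expR (l * phi X) in
  chi2 h <= 2 * l ^+ 2 * (K * Ex h).
Proof.
move=> a0 small; set h := fun X => _; rewrite /=.
have hp : pos_on h by move=> X _; rewrite mulr_gt0 // expR_gt0.
apply: le_trans (_ : _ <= 2 * l ^+ 2 * (\sum_(B : {set T} | #|B| == (n - 1)%N)
    \sum_b mu (b |: B) * (h (b |: B) * (phi (b |: B) - phi B) ^+ 2))) _; last first.
  by apply: ler_wpM2l (ES_le hp); rewrite mulr_ge0 // sqr_ge0.
rewrite mulr_sumr; apply: ler_sum => B /eqP cB.
have hB0 : 0 < h B by rewrite mulr_gt0 // expR_gt0.
have exp_near (x : R) : `|x| <= 10^-1 -> expR x <= 10 / 9 /\ (expR x - 1) ^+ 2 <= (10 / 9 * x) ^+ 2.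
  rewrite ler_norml => /andP[x1 x2].
  have e1 := expR_ge1Dx x; have e2 := expR_ge1Dx (- x).
  have e3 := expRxMexpNx_1 x; have e4 := expR_gt0 x.
  have e5 : expR x * (1 - x) <= 1 by rewrite -e3; apply: ler_wpM2l; [exact: ltW|lra].
  have e6 : expR x <= 10 / 9 by nra.
  split=> //; rewrite -subr_ge0 subr_sqr.
  have [x0|x0] := leP 0 x.
    by apply: mulr_ge0; nra.
  by rewrite -mulrNN; apply: mulr_ge0; nra.
have hb b : b \notin B -> h B * expR (l * (phi (b |: B) - phi B)) = h (b |: B).
  by move=> _; rewrite /h -mulrA -expRD; congr (_ * expR _); ring.
have lower b : b \notin B -> h B <= 10 / 9 * h (b |: B).
  move=> bB; have := small _ _ cB bB; rewrite -normrN => /exp_near[e _].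
  have := expRxMexpNx_1 (l * (phi (b |: B) - phi B)).
  rewrite -(hb _ bB) => E; have g0 := expR_gt0 (l * (phi (b |: B) - phi B)).
  move: E e g0; move: (expR (- _)) (expR _) => u v uv u9 v0.
  have v1 : 1 <= 10 / 9 * v by nra.
  by rewrite mulrCA ler_peMr // ltW.
apply: (@le_trans _ _ (\sum_b mu (b |: B) * (h (b |: B) - E_ h B) ^+ 2 * (10 / 9 / h B))).
  apply: ler_sum => b _; have [bB|bB] := boolP (b \in B).
    by rewrite mu_in // !mul0r.
  have h0 : 0 < h (b |: B) by rewrite hp // cardU.
  rewrite -mulrA; apply: ler_wpM2l => //; apply: ler_wpM2l; first exact: sqr_ge0.
  by rewrite ler_pdivlMr // mulrC ler_pdivrMr // lower.
rewrite -mulr_suml.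
have centred : \sum_b mu (b |: B) * (h (b |: B) - E_ h B) ^+ 2 <=
    \sum_b mu (b |: B) * (h (b |: B) - h B) ^+ 2.
  have -> : \sum_b mu (b |: B) * (h (b |: B) - h B) ^+ 2 =
    \sum_b mu (b |: B) * (h (b |: B) - E_ h B) ^+ 2 +
    (2 * (E_ h B - h B) * (\sum_b mu (b |: B) * (h (b |: B) - E_ h B)) +
     (E_ h B - h B) ^+ 2 * (\sum_b mu (b |: B))).
    by rewrite !mulr_sumr -!big_split; apply: eq_bigr => b _ /=; ring.
  by rewrite sum_centered // mulr0 add0r lerDl mulr_ge0 ?sqr_ge0 // sumr_ge0.
apply: le_trans (ler_wpM2r _ centred) _; first by rewrite divr_ge0 // ltW.
rewrite mulr_suml mulr_sumr; apply: ler_sum => b _.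
have [bB|bB] := boolP (b \in B); first by rewrite mu_in // !mul0r mulr0.
rewrite -[leLHS]mulrA [leRHS]mulrCA; apply: ler_wpM2l => //.
have [e1 e2] := exp_near _ (small _ _ cB bB).
have L := lower _ bB; rewrite -(hb _ bB) in L *.
have -> : h B * expR (l * (phi (b |: B) - phi B)) - h B =
   h B * (expR (l * (phi (b |: B) - phi B)) - 1) by ring.
have -> : (h B * (expR (l * (phi (b |: B) - phi B)) - 1)) ^+ 2 * (10 / 9 / h B) =
  h B * (10 / 9 * (expR (l * (phi (b |: B) - phi B)) - 1) ^+ 2) by field; rewrite gt_eqF.
have -> : 2 * l ^+ 2 * (h B * expR (l * (phi (b |: B) - phi B)) * (phi (b |: B) - phi B) ^+ 2) =
  h B * (2 * expR (l * (phi (b |: B) - phi B)) * (l * (phi (b |: B) - phi B)) ^+ 2) by ring.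
apply: ler_wpM2l; first exact: ltW.
have L' : 1 <= 10 / 9 * expR (l * (phi (b |: B) - phi B)) by nra.
move: e2 L'; move: (expR _) => e; move: (l * (phi (b |: B) - phi B)) => x; rewrite exprMn.
have := sqr_ge0 x; move: (x ^+ 2) ((e - 1) ^+ 2) => x2 z x20 zx e0.
have : x2 <= 10 / 9 * e * x2 by rewrite ler_peMl.
lra.
Qed.

End Observable.

(** The points of X :\: Y are exchanged one at a time for points of Y, in at most n exchanges. *)
Lemma lipschitz_dist (L : R) h (X Y : {set T}) : 0 <= L -> lipschitz L h ->
  #|X| = n -> #|Y| = n -> `|h X - h Y| <= n%:R * L.
Proof.
move=> L0 hl cX cY.
suff H k : forall Z : {set T}, #|Z| = n -> (#|Z :\: Y| <= k)%N -> `|h Z - h Y| <= k%:R * L.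
  by apply: H => //; rewrite -cX subset_leq_card // finset.subsetDl.
have same (Z : {set T}) : #|Z| = n -> #|Z :\: Y| = 0%N -> Z = Y.
  move=> cZ /eqP; rewrite cards_eq0 finset.setD_eq0 => sub.
  by apply/eqP; rewrite finset.eqEcard sub cZ cY /=.
elim: k => [|k IH] Z cZ.
  by rewrite leqn0 => /eqP /(same _ cZ) ->; rewrite subrr normr0 mul0r.
have [Z0|] := posnP #|Z :\: Y|.
  by rewrite (same _ cZ Z0) subrr normr0 mulr_ge0.
move=> Zpos Zk; case/card_gt0P: (Zpos) => e; rewrite !inE => /andP[eY eZ].
have : (0 < #|Y :\: Z|)%N.
  have := Zpos; rewrite !cardsD cZ cY finset.setIC.
  by [].
case/card_gt0P => f; rewrite !inE => /andP[fZ fY].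
have cZe : #|Z :\ e| = (n - 1)%N by move: cZ; rewrite (cardsD1 e Z) eZ add1n subn1 => <-.
have fZe : f \notin Z :\ e by rewrite !inE (negPf fZ) andbF.
have eZe : e \notin Z :\ e by rewrite !inE eqxx.
apply: le_trans (ler_distD (h (f |: Z :\ e)) _ _) _.
rewrite -natr1 mulrDl mul1r addrC; apply: lerD.
  apply: IH; first by rewrite cardU.
  have -> : (f |: Z :\ e) :\: Y = (Z :\: Y) :\ e.
    apply/setP => x; rewrite !inE; case: (eqVneq x f) => [->|_] /=.
      by rewrite fY andbF.
    by rewrite andbCA.
  by move: Zk; rewrite (cardsD1 e (Z :\: Y)) !inE eY eZ add1n ltnS.
by rewrite -{1}(finset.setD1K eZ); exact: hl.
Qed.

Let tau_gt0 : 0 < tau. Proof. by rewrite subr_gt0. Qed.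
Let tau_le1 : tau <= 1. Proof. by rewrite gerBl. Qed.

(** Small enough for both uses: r^2 - 1 <= tau / 24 for the contraction of [chi2], and r^3 rho <= 1
    for the preservation of the regularity. *)
Let r := 1 + tau / 50.
Let r_ge1 : 1 <= r. Proof. by rewrite lerDl divr_ge0 // ltW. Qed.
Let r_sq : r ^+ 2 - 1 <= tau / 24.
Proof. by have := tau_gt0; have := tau_le1; rewrite /r; nra. Qed.
Let r_cube : r ^+ 3 * rho <= 1.
Proof.
have -> : rho = 1 - tau by rewrite /tau; ring.
have t0 := tau_gt0; have t1 := tau_le1; have s := r_sq.
have r3 : r ^+ 3 <= 1 + tau / 10.
  rewrite exprS; apply: (@le_trans _ _ (r * (1 + tau / 24))).
    by apply: ler_wpM2l; [exact: le_trans r_ge1 | lra].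
  by rewrite /r; nra.
apply: (@le_trans _ _ ((1 + tau / 10) * (1 - tau))); last by nra.
by apply: ler_wpM2r => //; lra.
Qed.

Lemma iter_resample_reg k h : pos_on h -> log_lipschitz r h ->
  pos_on (iter k P h) /\ log_lipschitz r (iter k P h).
Proof.
move=> hp hl; elim: k => // k [IHp IHl]; split; first exact: resample_gt0.
exact: resample_log_lipschitz.
Qed.

(** An upper bound for the square root of the decay rate 1 - tau / (2n) of [chi2]. *)
Let q := 1 - tau / (4 * n%:R).
Let q_gt0 : 0 < q.
Proof.
rewrite subr_gt0 ltr_pdivrMr ?mulr_gt0 // mul1r.
have := n_ge2R; have := tau_le1; lra.
Qed.

Lemma chi2_iter_resample k h : pos_on h -> log_lipschitz r h ->
  chi2 (iter k P h) <= q ^+ (2 * k) * chi2 h.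
Proof.
move=> hp hl; elim: k => [|k IH]; first by rewrite muln0 expr0 mul1r.
have [IHp IHl] := iter_resample_reg k hp hl.
apply: le_trans (chi2_resample_contraction r_ge1 r_sq IHp IHl) _.
have gq : 1 - tau / (2 * n%:R) <= q ^+ 2.
  rewrite /q invfM [(4 * _)^-1]invfM; have := sqr_ge0 (tau * (4^-1 * n%:R^-1)).
  rewrite !expr2; move: (n%:R^-1) => x; nra.
have g0 : 0 <= 1 - tau / (2 * n%:R).
  rewrite subr_ge0 ler_pdivrMr ?mulr_gt0 // mul1r.
  have := n_ge2R; have := tau_le1; lra.
apply: le_trans (ler_wpM2l g0 IH) _; rewrite mulnS exprD -mulrA.
apply: ler_wpM2r gq; rewrite mulr_ge0 ?exprn_ge0 ?(ltW q_gt0) //.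
apply: sumr_ge0 => B /eqP cB; apply: sumr_ge0 => b _.
have [bB|bB] := boolP (b \in B); first by rewrite mu_in // mul0r.
by rewrite mulr_ge0 // divr_ge0 ?sqr_ge0 // ltW // hp // cardU.
Qed.

Lemma expectation_iter_resample k h : Ex (iter k P h) = Ex h.
Proof. by elim: k => //= k IH; rewrite expectation_resample. Qed.

Let Ex1 : Ex (fun=> 1) = 1.
Proof. by rewrite /Ex; under eq_bigr do rewrite mulr1; case: mu_distr. Qed.

(** A qualitative statement, serving only to let k tend to infinity in the telescoping sum, so C may
    depend on [h] and n: by the Lipschitz contraction P^k h flattens to its mean 1. *)
Lemma expectation_iter_resample_limit phi h : Ex h = 1 -> exists2 C, 0 <= C &
  forall k, `|Ex (fun X => phi X * iter k P h X) - Ex phi| <= C * (1 - tau / n%:R) ^+ k.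
Proof.
move=> Eh; pose L0 := \sum_X `|h X| + \sum_X `|h X|.
have L00 : 0 <= L0 by rewrite addr_ge0 // sumr_ge0.
have c0 : 0 <= 1 - tau / n%:R.
  rewrite subr_ge0 ler_pdivrMr // mul1r; have := n_ge2R; have := tau_le1; lra.
have hl k : lipschitz ((1 - tau / n%:R) ^+ k * L0) (iter k P h).
  elim: k => [|k IH] /=.
    move=> B cB b c bB cB'; rewrite mul1r.
    apply: le_trans (ler_normB _ _) _; apply: lerD.
      by rewrite [leRHS](bigD1 (b |: B)) //= lerDl sumr_ge0.
    by rewrite [leRHS](bigD1 (c |: B)) //= lerDl sumr_ge0.
  by rewrite exprS -mulrA; apply: resample_lipschitz => //; rewrite mulr_ge0 // exprn_ge0.
exists ((\sum_X mu X * `|phi X|) * (n%:R * L0)).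
  by rewrite !mulr_ge0 ?sumr_ge0 // => X _; rewrite mulr_ge0.
move=> k; rewrite /Ex -sumrB mulr_suml mulr_suml.
apply: le_trans (ler_norm_sum _ _ _) _; apply: ler_sum => X _.
have [cX|cX] := eqVneq #|X| n; last by rewrite mu0 // !mul0r subrr normr0.
have -> : mu X * (phi X * iter k P h X) - mu X * phi X =
  mu X * (phi X * (iter k P h X - 1)) by ring.
rewrite !normrM ger0_norm // -!mulrA; apply: ler_wpM2l => //; apply: ler_wpM2l => //.
have -> : iter k P h X - 1 = \sum_Y mu Y * (iter k P h X - iter k P h Y).
  rewrite -Eh -(expectation_iter_resample k) /Ex.
  under [RHS]eq_bigr do rewrite mulrBr.
  by rewrite sumrB -mulr_suml; case: mu_distr => _ _ ->; rewrite mul1r.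
apply: le_trans (ler_norm_sum _ _ _) _.
apply: (@le_trans _ _ (\sum_Y mu Y * (n%:R * ((1 - tau / n%:R) ^+ k * L0)))); last first.
  rewrite -mulr_suml; case: mu_distr => _ _ ->; rewrite mul1r ler_wpM2l ?(ltW n_gt0) //.
  by rewrite mulrC.
apply: ler_sum => Y _; have [cY|cY] := eqVneq #|Y| n; last by rewrite mu0 // !mul0r normr0.
rewrite normrM ger0_norm //; apply: ler_wpM2l => //; apply: lipschitz_dist => //.
by rewrite mulr_ge0 // exprn_ge0.
Qed.

(** * Tilted means and exponential tails *)

Section Concentration.
Variables (phi : {set T} -> R) (K delta : R).
Hypothesis K_gt0 : 0 < K.
Hypothesis phi_lip : forall B b, #|B| = (n - 1)%N -> b \notin B ->
  `|phi (b |: B) - phi B| <= delta.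
Hypothesis efron_stein : forall X, #|X| = n ->
  \sum_(b in X) (phi X - phi (X :\ b)) ^+ 2 <= K.

Lemma tilted_mean_le (l a : R) : 0 < l -> 0 < a -> l * delta <= tau / 200 ->
  Ex (fun X => a * expR (l * phi X)) = 1 ->
  Ex (fun X => phi X * (a * expR (l * phi X))) <= Ex phi + 6 * K * l / tau.
Proof.
move=> l0 a0 ld; set h := fun X => a * expR (l * phi X) => Eh.
have t0 := tau_gt0; have t1 := tau_le1.
have hp : pos_on h by move=> X _; rewrite mulr_gt0 // expR_gt0.
have lphi B b : #|B| = (n - 1)%N -> b \notin B -> `|l * (phi (b |: B) - phi B)| <= tau / 200.
  move=> cB bB; rewrite normrM gtr0_norm //; apply: le_trans ld.
  by apply: ler_wpM2l (phi_lip cB bB); exact: ltW.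
have hl : log_lipschitz r h.
  move=> B cB b c bB cB'.
  have -> : h (b |: B) = expR (l * (phi (b |: B) - phi (c |: B))) * h (c |: B).
    by rewrite /h mulrCA -expRD; congr (_ * expR _); ring.
  apply: ler_wpM2r; first by rewrite ltW // hp // cardU.
  (* Two neighbours differ through B by two increments of tau / 200, and e^(tau/100) <= 1 + tau / 50
     = r. *)
  apply: (@le_trans _ _ (expR (tau / 100))).
    rewrite ler_expR; have := lphi _ _ cB bB; have := lphi _ _ cB cB'.
    rewrite !ler_norml !mulrBr => /andP[? ?] /andP[? ?]; lra.
  have := expRxMexpNx_1 (tau / 100); have := expR_ge1Dx (- (tau / 100)).
  have := expR_gt0 (tau / 100); move: (expR _) (expR (- _)) => u v u0 v1 uv.
  rewrite /r; nra.
have chi_le : chi2 h <= 2 * l ^+ 2 * K.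
  have small B b : #|B| = (n - 1)%N -> b \notin B -> `|l * (phi (b |: B) - phi B)| <= 10^-1.
    by move=> cB bB; apply: le_trans (lphi _ _ cB bB) _; lra.
  by have := chi2_expR_le efron_stein a0 small; rewrite /= Eh mulr1.
(* Step k uses s = l q^k. As [chi2] is then at most 2 l^2 K q^(2k), both terms of
   [expectation_step_le] are multiples of K l q^k, and the step costs 3 K l q^k / (2n). *)
have partial N : `|Ex (fun X => phi X * h X) - Ex (fun X => phi X * iter N P h X)| <=
    3 * K * l / (2 * n%:R) * \sum_(k < N) q ^+ k.
  elim: N => [|N IH]; first by rewrite big_ord0 mulr0 subrr normr0.
  apply: le_trans (ler_distD (Ex (fun X => phi X * iter N P h X)) _ _) _.
  rewrite big_ord_recr mulrDr; apply: lerD => //.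
  have [hNp hNl] := iter_resample_reg N hp hl.
  have qN : 0 < q ^+ N by rewrite exprn_gt0.
  apply: le_trans (expectation_step_le efron_stein hNp (mulr_gt0 l0 qN)) _.
  rewrite expectation_iter_resample Eh mulr1.
  have cN : chi2 (iter N P h) <= q ^+ (2 * N) * (2 * l ^+ 2 * K).
    apply: le_trans (chi2_iter_resample N hp hl) _; apply: ler_wpM2l => //.
    by rewrite exprn_ge0 // ltW.
  rewrite [leRHS](_ : _ = (2 * n%:R)^-1 * (3 * K * l * q ^+ N)); last by rewrite /=; ring.
  apply: ler_wpM2l; first by rewrite invr_ge0 mulr_ge0 // ltW.
  have -> : 3 * K * l * q ^+ N = l * q ^+ N * K + (l * q ^+ N)^-1 * (q ^+ (2 * N) * (2 * l ^+ 2 * K)).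
    rewrite mulnC exprM; field; rewrite !gt_eqF //.
  by rewrite lerD2l ler_wpM2l // invr_ge0 ltW // mulr_gt0.
have geom N : \sum_(k < N) q ^+ k <= 4 * n%:R / tau.
  have := subrX1 q N; have qN : 0 < q ^+ N by rewrite exprn_gt0.
  rewrite {2}/q addrAC subrr add0r mulNr => E.
  rewrite ler_pdivlMr //.
  have -> : (\sum_(k < N) q ^+ k) * tau = (1 - q ^+ N) * (4 * n%:R).
    rewrite -(opprB (q ^+ N)) E; field; rewrite gt_eqF //.
  rewrite -[leRHS]mul1r ler_wpM2r ?mulr_ge0 ?(ltW n_gt0) //; lra.
have [C C0 lim] := expectation_iter_resample_limit phi Eh.
have bound N : Ex (fun X => phi X * h X) - (Ex phi + 6 * K * l / tau) <=
    C * (1 - tau / n%:R) ^+ N.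
  have A1 := partial N; have A2 := lim N.
  have A3 : 3 * K * l / (2 * n%:R) * \sum_(k < N) q ^+ k <= 6 * K * l / tau.
    have -> : 6 * K * l / tau = 3 * K * l / (2 * n%:R) * (4 * n%:R / tau).
      by field; rewrite !gt_eqF.
    apply: ler_wpM2l (geom N); by rewrite divr_ge0 ?mulr_ge0 ?(ltW K_gt0) ?(ltW l0) // ltW.
  move: A1 A2; rewrite !ler_norml => /andP[_ A1] /andP[_ A2]; lra.
rewrite -subr_le0 leNgt; apply/negP; set d := Ex _ - _ in bound * => d0.
have c1 : `|1 - tau / n%:R| < 1.
  have : 0 < tau / n%:R by rewrite divr_gt0.
  have : tau / n%:R <= 1 by rewrite ler_pdivrMr // mul1r; have := n_ge2R; lra.
  by move=> x y; rewrite ltr_norml; lra.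
have C1 : 0 < C + 1 by lra.
have [N _ /(_ N (leqnn _))] := @cvgr0_norm_lt _ _ _ _ _ _ (cvg_expr c1) _ (divr_gt0 d0 C1).
have := bound N; set y := (1 - tau / n%:R) ^+ N => dy.
rewrite -[X in `|X|]/y ltr_pdivlMr // => yC.
have y1 := ler_norm y; have y0 := normr_ge0 y.
have : C * y <= C * `|y| by apply: ler_wpM2l.
move: yC y0 dy; rewrite mulrDr mulr1 mulrC; lra.
Qed.

Lemma upper_tail_le (u : R) : 0 < u -> u * delta <= 3 / 50 * K ->
  Pr mu (fun X => Ex phi + u <= phi X) <= expR (- (u ^+ 2 * tau / (24 * K))).
Proof.
move=> u0 ud; have t0 := tau_gt0.
(* With this l the shift 6 K l / tau of the tilted mean is u / 2, and the hypothesis on u * delta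
   becomes l * delta <= tau / 200. *)
pose l := u * tau / (12 * K).
have l0 : 0 < l by rewrite divr_gt0 ?mulr_gt0.
have ld : l * delta <= tau / 200.
  rewrite /l mulrAC ler_pdivrMr ?mulr_gt0 //.
  have := ler_wpM2r (ltW t0) ud; lra.
pose mgf := Ex (fun X => expR (l * phi X)).
have mgf0 : 0 < mgf.
  have [X X0] : exists X, mu X != 0.
    apply/existsP; apply: contraT; rewrite negb_exists => /forallP all0.
    case: mu_distr => _ _; rewrite big1 => [/eqP|X _]; first by rewrite eq_sym oner_eq0.
    by apply/eqP; move: (all0 X); rewrite negbK.
  rewrite /mgf /Ex (bigD1 X) //= ltr_pwDl //.
    by rewrite mulr_gt0 ?expR_gt0 // lt0r X0 mu_ge0.
  by apply: sumr_ge0 => Y _; rewrite mulr_ge0 // expR_ge0.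
have Eh : Ex (fun X => mgf^-1 * expR (l * phi X)) = 1.
  have mgfN0 : mgf != 0 by rewrite gt_eqF.
  rewrite -[RHS](mulVf mgfN0).
  rewrite {2}/mgf /Ex mulr_sumr; apply: eq_bigr => X _; ring.
have mi0 : 0 < mgf^-1 by rewrite invr_gt0.
have shift := tilted_mean_le l0 mi0 ld Eh.
set a := Ex (fun X => phi X * _) in shift.
(* Jensen under the tilted law: the mean of e^(- l (phi - a)) is at least 1, and it equals e^(l a) /
   mgf. *)
have mgf_le : mgf <= expR (l * a).
  rewrite -[leLHS]mul1r -ler_pdivlMr //.
  apply: (@le_trans _ _ (Ex (fun X => mgf^-1 * expR (l * phi X) * (1 - l * (phi X - a))))).
    have -> : Ex (fun X => mgf^-1 * expR (l * phi X) * (1 - l * (phi X - a))) =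
      (1 + l * a) * Ex (fun X => mgf^-1 * expR (l * phi X))
        - l * Ex (fun X => phi X * (mgf^-1 * expR (l * phi X))).
      move: a {shift} => c; rewrite /Ex !mulr_sumr -sumrB; apply: eq_bigr => X _; ring.
    by rewrite Eh mulr1 -/a addrK.
  have -> : expR (l * a) / mgf = Ex (fun X => mgf^-1 * expR (l * phi X) * expR (- (l * (phi X - a)))).
    transitivity (expR (l * a) / mgf * Ex (fun=> 1)); first by rewrite Ex1 mulr1.
    rewrite /Ex mulr_sumr; apply: eq_bigr => X _.
    have -> : expR (l * a) = expR (l * phi X) * expR (- (l * (phi X - a))).
      by rewrite -expRD; congr expR; ring.
    ring.
  apply: ler_sum => X _; apply: ler_wpM2l => //; apply: ler_wpM2l.
    by rewrite mulr_ge0 ?invr_ge0 ?expR_ge0 ?(ltW mgf0).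
  exact: expR_ge1Dx.
apply: (@le_trans _ _ (mgf / expR (l * (Ex phi + u)))).
  rewrite /mgf /Ex mulr_suml /Pr big_mkcond; apply: ler_sum => X _.
  case: ifP => [H|_]; last by rewrite divr_ge0 ?mulr_ge0 ?expR_ge0.
  rewrite ler_pdivlMr ?expR_gt0 // ler_wpM2l // ler_expR ler_wpM2l // ltW //.
apply: (@le_trans _ _ (expR (l * a) / expR (l * (Ex phi + u)))).
  by rewrite ler_wpM2r // invr_ge0 expR_ge0.
rewrite -expRN -expRD ler_expR.
have := ler_wpM2l (ltW l0) shift.
have E1 : l * u = 2 * (u ^+ 2 * tau / (24 * K)) by rewrite /l; field; rewrite gt_eqF.
have E2 : l * (6 * K * l / tau) = u ^+ 2 * tau / (24 * K).
  by rewrite /l; field; rewrite !gt_eqF.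
rewrite !(mulrDr l) E1 E2; lra.
Qed.

End Concentration.
End SubsetDynamics.

(** * Space-filling order *)

Section SpaceFillingOrder.
Variables (R : realFieldType) (I : eqType) (pt : I -> R * R).

Let sqd (p q : R * R) := (p.1 - q.1) ^+ 2 + (p.2 - q.2) ^+ 2.

Fixpoint sqr_path (p : R * R) (s : seq I) (q : R * R) : R :=
  if s is x :: s' then sqd p (pt x) + sqr_path (pt x) s' q else sqd p q.

(** A single step crosses from the first path to the second. Which points it joins depends on
    whether [s1] and [s2] are empty, hence the hypothesis on all pairs. *)
Lemma sqr_path_cat (c q : R * R) (s1 s2 : seq I) (p : R * R) :
  (forall y, y \in q :: map pt s2 -> forall x, x \in p :: map pt s1 ->
    sqd x y <= sqd x c + sqd c y) ->
  sqr_path p (s1 ++ s2) q <= sqr_path p s1 c + sqr_path c s2 q.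
Proof.
elim: s1 p => [|z s1 IH] p H /=.
  case: s2 H => [|y s2] H /=; first by apply: H; rewrite ?inE.
  by rewrite [leRHS]addrA lerD2r; apply: H; rewrite ?inE ?eqxx ?orbT.
rewrite -[leRHS]addrA lerD2l; apply: IH => y yq x xp; apply: H => //.
by rewrite inE xp orbT.
Qed.

Let in_triangle (c a b : R * R) (u v : I -> R) (s : seq I) := forall i, i \in s ->
  [/\ 0 <= u i, 0 <= v i, u i + v i <= 1 &
      pt i = (c.1 + u i * a.1 + v i * b.1, c.2 + u i * a.2 + v i * b.2)].

(* A path through a right isosceles triangle, from one end of the hypotenuse
   to the other, is assembled from paths through the two halves cut by the
   altitude; at the apex [c] the angle is at most a right angle, so bypassing
   [c] does not increase the sum of squares. After [k] bisections the crude
   bound (square of the hypotenuse per step) is used. *)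
Lemma triangle_order (k : nat) : forall (c a b : R * R) (L : R) (u v : I -> R) (s : seq I),
  a.1 * b.1 + a.2 * b.2 = 0 -> a.1 ^+ 2 + a.2 ^+ 2 = L -> b.1 ^+ 2 + b.2 ^+ 2 = L ->
  in_triangle c a b u v s ->
  exists2 s', perm_eq s' s &
    sqr_path (c.1 + a.1, c.2 + a.2) s' (c.1 + b.1, c.2 + b.2) <=
      2 * L + (size s)%:R * (2 * L / 2 ^+ k).
Proof.
have dist_tri (c a b : R * R) L (u v u' v' : R) :
    a.1 * b.1 + a.2 * b.2 = 0 -> a.1 ^+ 2 + a.2 ^+ 2 = L -> b.1 ^+ 2 + b.2 ^+ 2 = L ->
    sqd (c.1 + u * a.1 + v * b.1, c.2 + u * a.2 + v * b.2)
        (c.1 + u' * a.1 + v' * b.1, c.2 + u' * a.2 + v' * b.2) =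
    L * ((u - u') ^+ 2 + (v - v') ^+ 2).
  move=> ab aL bL; rewrite /sqd /=.
  transitivity ((u - u') ^+ 2 * (a.1 ^+ 2 + a.2 ^+ 2) + (v - v') ^+ 2 * (b.1 ^+ 2 + b.2 ^+ 2)
    + 2 * (u - u') * (v - v') * (a.1 * b.1 + a.2 * b.2)); first by ring.
  by rewrite ab aL bL; ring.
elim: k => [|k IH] c a b L u v s ab aL bL tri.
  exists s => //; rewrite expr0 divr1.
  have L0 : 0 <= L by rewrite -aL addr_ge0 ?sqr_ge0.
  have step (x y x' y' : R) : 0 <= x -> 0 <= y -> x + y <= 1 -> 0 <= x' -> 0 <= y' ->
      x' + y' <= 1 -> L * ((x - x') ^+ 2 + (y - y') ^+ 2) <= 2 * L.
    move=> x0 y0 xy x'0 y'0 xy'; rewrite mulrC ler_wpM2r //.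
    have : 0 <= (1 - (x - x')) * (1 + (x - x')) by apply: mulr_ge0; lra.
    have : 0 <= (1 - (y - y')) * (1 + (y - y')) by apply: mulr_ge0; lra.
    lra.
  have -> : (c.1 + a.1, c.2 + a.2) = (c.1 + 1 * a.1 + 0 * b.1, c.2 + 1 * a.2 + 0 * b.2).
    by congr (_, _); ring.
  have -> : (c.1 + b.1, c.2 + b.2) = (c.1 + 0 * a.1 + 1 * b.1, c.2 + 0 * a.2 + 1 * b.2).
    by congr (_, _); ring.
  suff gen x y : 0 <= x -> 0 <= y -> x + y <= 1 ->
      sqr_path (c.1 + x * a.1 + y * b.1, c.2 + x * a.2 + y * b.2) s
        (c.1 + 0 * a.1 + 1 * b.1, c.2 + 0 * a.2 + 1 * b.2) <= 2 * L + (size s)%:R * (2 * L).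
    by apply: gen; rewrite ?addr0.
  elim: s x y tri => [|i s IHs] x y tri x0 y0 xy /=.
    rewrite (dist_tri _ _ _ L) // mul0r addr0; apply: step => //; lra.
  have [u0 v0 uv E] := tri i (mem_head _ _).
  rewrite E (dist_tri _ _ _ L) //.
  have := step x y (u i) (v i) x0 y0 xy u0 v0 uv.
  have tri' : in_triangle c a b u v s by move=> j js; apply: tri; rewrite inE js orbT.
  have := IHs (u i) (v i) tri' u0 v0 uv.
  rewrite -natr1; lra.
(* h is the foot of the altitude; d, g and d' lead from it to c + a, to the apex c and to c + b. In
   the two halves, whose squared legs are L / 2, the coordinates become 1 - u - v along g and u - v
   along d or v - u along d'. *)
pose h := (c.1 + (a.1 + b.1) / 2, c.2 + (a.2 + b.2) / 2).
pose d := ((a.1 - b.1) / 2, (a.2 - b.2) / 2).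
pose d' := ((b.1 - a.1) / 2, (b.2 - a.2) / 2).
pose g := (- ((a.1 + b.1) / 2), - ((a.2 + b.2) / 2)).
pose s1 := [seq i <- s | v i <= u i]; pose s2 := [seq i <- s | ~~ (v i <= u i)].
have [t1 p1 b1] : exists2 s', perm_eq s' s1 &
    sqr_path (h.1 + d.1, h.2 + d.2) s' (h.1 + g.1, h.2 + g.2) <=
      2 * (L / 2) + (size s1)%:R * (2 * (L / 2) / 2 ^+ k).
  apply: (IH h d g (L / 2) (fun i => u i - v i) (fun i => 1 - u i - v i)) => /=.
  - transitivity ((b.1 ^+ 2 + b.2 ^+ 2 - (a.1 ^+ 2 + a.2 ^+ 2)) / 4); first by field.
    by rewrite aL bL subrr mul0r.
  - transitivity ((a.1 ^+ 2 + a.2 ^+ 2 + (b.1 ^+ 2 + b.2 ^+ 2) - 2 * (a.1 * b.1 + a.2 * b.2)) / 4); first by field.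
    by rewrite aL bL ab; field.
  - transitivity ((a.1 ^+ 2 + a.2 ^+ 2 + (b.1 ^+ 2 + b.2 ^+ 2) + 2 * (a.1 * b.1 + a.2 * b.2)) / 4); first by field.
    by rewrite aL bL ab; field.
  move=> i; rewrite mem_filter => /andP[vu /tri[u0 v0 uv ->]]; split; [lra|lra|lra|].
  by rewrite /=; congr (_, _); field.
have [t2 p2 b2] : exists2 s', perm_eq s' s2 &
    sqr_path (h.1 + g.1, h.2 + g.2) s' (h.1 + d'.1, h.2 + d'.2) <=
      2 * (L / 2) + (size s2)%:R * (2 * (L / 2) / 2 ^+ k).
  apply: (IH h g d' (L / 2) (fun i => 1 - u i - v i) (fun i => v i - u i)) => /=.
  - transitivity ((a.1 ^+ 2 + a.2 ^+ 2 - (b.1 ^+ 2 + b.2 ^+ 2)) / 4); first by field.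
    by rewrite aL bL subrr mul0r.
  - transitivity ((a.1 ^+ 2 + a.2 ^+ 2 + (b.1 ^+ 2 + b.2 ^+ 2) + 2 * (a.1 * b.1 + a.2 * b.2)) / 4); first by field.
    by rewrite aL bL ab; field.
  - transitivity ((a.1 ^+ 2 + a.2 ^+ 2 + (b.1 ^+ 2 + b.2 ^+ 2) - 2 * (a.1 * b.1 + a.2 * b.2)) / 4); first by field.
    by rewrite aL bL ab; field.
  move=> i; rewrite mem_filter -ltNge => /andP[vu /tri[u0 v0 uv ->]]; split; [lra|lra|lra|].
  by rewrite /=; congr (_, _); field.
exists (t1 ++ t2).
  apply: perm_trans (perm_cat p1 p2) _.
  by rewrite /s1 /s2; apply/permPl; exact: perm_filterC.
have EA : (h.1 + d.1, h.2 + d.2) = (c.1 + a.1, c.2 + a.2).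
  by rewrite /=; congr (_, _); field.
have EC : (h.1 + g.1, h.2 + g.2) = (c.1, c.2) by rewrite /=; congr (_, _); ring.
have EB : (h.1 + d'.1, h.2 + d'.2) = (c.1 + b.1, c.2 + b.2).
  by rewrite /=; congr (_, _); field.
rewrite EA EC in b1; rewrite EB EC in b2.
have sz : size s = (size s1 + size s2)%N.
  by rewrite /s1 /s2 !size_filter count_predC.
apply: le_trans (_ : _ <= sqr_path (c.1 + a.1, c.2 + a.2) t1 (c.1, c.2) +
   sqr_path (c.1, c.2) t2 (c.1 + b.1, c.2 + b.2)) _; last first.
  apply: le_trans (lerD b1 b2) _; rewrite sz natrD exprS.
  have e0 : 2 ^+ k != 0 :> R by rewrite expf_neq0.
  rewrite le_eqVlt; apply/orP; left; apply/eqP; field.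
  by rewrite e0.
apply: sqr_path_cat => y yB x xA.
have [ux [vx [ux0 vx0 ->]]] : exists u0 v0, [/\ 0 <= u0, 0 <= v0 &
    x = (c.1 + u0 * a.1 + v0 * b.1, c.2 + u0 * a.2 + v0 * b.2)].
  move: xA; rewrite inE => /orP[/eqP ->|/mapP[i]].
    by exists 1, 0; split => //; congr (_, _); ring.
  rewrite (perm_mem p1) mem_filter => /andP[_ /tri[u0 v0 uv E]] ->.
  by exists (u i), (v i).
have [uy [vy [uy0 vy0 ->]]] : exists u0 v0, [/\ 0 <= u0, 0 <= v0 &
    y = (c.1 + u0 * a.1 + v0 * b.1, c.2 + u0 * a.2 + v0 * b.2)].
  move: yB; rewrite inE => /orP[/eqP ->|/mapP[i]].
    by exists 0, 1; split => //; congr (_, _); ring.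
  rewrite (perm_mem p2) mem_filter => /andP[_ /tri[u0 v0 uv E]] ->.
  by exists (u i), (v i).
have EC0 : (c.1, c.2) = (c.1 + 0 * a.1 + 0 * b.1, c.2 + 0 * a.2 + 0 * b.2).
  by congr (_, _); ring.
rewrite EC0 !(dist_tri _ _ _ L) // -mulrDr; apply: ler_wpM2l.
  by rewrite -aL addr_ge0 ?sqr_ge0.
rewrite !subr0 !sub0r !sqrrN.
by have := mulr_ge0 ux0 uy0; have := mulr_ge0 vx0 vy0; rewrite !sqrrB; lra.
Qed.

Lemma unit_square_order (s : seq I) :
  (forall i, i \in s -> 0 <= (pt i).1 <= 1 /\ 0 <= (pt i).2 <= 1) ->
  exists2 s', perm_eq s' s & sqr_path (2, 0) s' (0, 2) <= 16.
Proof.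
move=> sq.
(* The triangle (0,0), (2,0), (0,2) contains the square and has squared legs 4. With as many
   bisections as points the remainder 8 |s| / 2^|s| is at most 8, so the total is at most 8 + 8. *)
have [||||s' ps' bound] := @triangle_order (size s) (0, 0) (2, 0) (0, 2) 4
  (fun i => (pt i).1 / 2) (fun i => (pt i).2 / 2) s.
- by rewrite /=; ring.
- by rewrite /=; ring.
- by rewrite /=; ring.
- move=> i /sq[/andP[? ?] /andP[? ?]]; split; [lra|lra|lra|].
  by rewrite [LHS]surjective_pairing /=; congr (_, _); field.
exists s' => //; move: bound; rewrite /= !add0r => /le_trans; apply.
have : (size s)%:R / 2 ^+ size s <= 1 :> R.
  rewrite ler_pdivrMr ?exprn_gt0 // mul1r -natrX ler_nat ltnW //; exact: ltn_expl.
have -> : (size s)%:R * (2 * 4 / 2 ^+ size s) = 8 * ((size s)%:R / 2 ^+ size s) :> R by ring.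
lra.
Qed.

End SpaceFillingOrder.

(** * Truncated length *)

Section Truncation.
Variables (R : realType) (T : finType) (S : {set T} -> R) (d : T -> T -> R) (far delta : R).
Hypothesis delta_gt0 : 0 < delta.
Hypothesis d_ge0 : forall x y, 0 <= d x y.
Hypothesis far_ge0 : 0 <= far.
Hypothesis S_mono : forall V W : {set T}, V \subset W -> S V <= S W.
Hypothesis S_attach : forall (V : {set T}) x v, v \in V -> S (x |: V) <= S V + d x v.
Hypothesis S_far : forall (V : {set T}) x, S (x |: V) <= S V + far.
Implicit Types (V W X : {set T}) (s : seq T).

Definition truncation X : R :=
  \big[Num.min/S X]_(V : {set T} | V \subset X) (S V + delta * #|X :\: V|%:R).

Lemma truncation_le V X : V \subset X -> truncation X <= S V + delta * #|X :\: V|%:R.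
Proof. exact: (bigmin_le_cond _ (fun V => S V + delta * #|X :\: V|%:R)). Qed.

Lemma truncation_le_id X : truncation X <= S X.
Proof. exact: bigmin_le_id. Qed.

Let card_diff V X : V \subset X -> #|X :\: V|%:R = #|X|%:R - #|V|%:R :> R.
Proof.
by move=> VX; rewrite cardsD (finset.setIidPr VX) natrB // subset_leq_card.
Qed.

Lemma truncation_attained X : exists2 V : {set T}, V \subset X &
  truncation X = S V + delta * #|X :\: V|%:R.
Proof.
have /bigmin_leP[SX|[V VX le]] := lexx (truncation X).
  exists X => //; apply/le_anti; rewrite truncation_le //=.
  by rewrite finset.setDv cards0 mulr0 addr0.
by exists V => //; apply/le_anti; rewrite le truncation_le.
Qed.

(** Intersect an optimal V for b |: B with B: the length does not grow and no further point is left
    out. *)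
Lemma truncation_mono (B : {set T}) b : truncation B <= truncation (b |: B).
Proof.
have [V VX ->] := truncation_attained (b |: B).
apply: le_trans (truncation_le (finset.subsetIr V B)) _; apply: lerD.
  by apply: S_mono; exact: finset.subsetIl.
apply: ler_wpM2l; first exact: ltW.
rewrite ler_nat; apply: subset_leq_card; apply/fintype.subsetP => x.
by rewrite !inE => /andP[+ xB]; rewrite xB andbT orbT andbT.
Qed.

Lemma truncation_lip (B : {set T}) b : truncation (b |: B) <= truncation B + delta.
Proof.
have [V VX ->] := truncation_attained B.
have VbB : V \subset b |: B by apply: fintype.subset_trans VX _; exact: finset.subsetUr.
apply: le_trans (truncation_le VbB) _; rewrite -addrA lerD2l.
have -> : delta * #|B :\: V|%:R + delta = delta * (#|B :\: V|%:R + 1) by ring.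
apply: ler_wpM2l; first exact: ltW.
rewrite natr1 ler_nat; apply: (@leq_trans #|b |: (B :\: V)|).
  apply: subset_leq_card; apply/fintype.subsetP => x; rewrite !inE.
  by case/andP=> xV /orP[->//|xB]; rewrite xV xB orbT.
by rewrite cardsU1; case: (_ \notin _); rewrite ?add1n // add0n leqW.
Qed.

(** The last point of an order has no successor; it is joined at the price [far], which is available
    even when the tree is empty. *)
Definition link_cost x s : R := if s is y :: _ then d x y else far.

Fixpoint sqr_cost s : R :=
  if s is x :: s' then link_cost x s' ^+ 2 + sqr_cost s' else 0.

(* The workload of a queue served at rate [delta] per point, with arrivals the
   link costs: joining [x] to a tree avoiding all of [x :: s] changes the
   penalised length by at most [link_cost x s + workload s - delta], since one
   may stop following the order as soon as the tree is met. *)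
Fixpoint workload s : R :=
  if s is x :: s' then Num.max 0 (link_cost x s' + workload s' - delta) else 0.

(** The work done in one slot of the queue. It bounds the increment of the truncation at x, which is
    at most delta (leave x out) and at most the cost of joining x along the order. *)
Definition served x s : R := Num.min delta (link_cost x s + workload s).

Fixpoint sqr_served s : R :=
  if s is x :: s' then served x s' ^+ 2 + sqr_served s' else 0.

Let link_cost_ge0 x s : 0 <= link_cost x s. Proof. by case: s => [|y s] /=. Qed.

Let workload_ge0 s : 0 <= workload s.
Proof. by case: s => //= x s; rewrite le_max lexx. Qed.

(** The potential 2 delta workload pays for the work served. With link cost c and workload w, a slot
    with c + w >= delta leaves (c - delta)^2 >= 0, and a slot with c + w < delta leaves w (2 delta -
    2 c - w) >= 0. *)
Lemma sqr_served_le s : sqr_served s + 2 * delta * workload s <= sqr_cost s.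
Proof.
elim: s => [|x s IH] /=; first by rewrite mulr0 addr0.
apply: le_trans (lerD (lexx (link_cost x s ^+ 2)) IH).
rewrite [leRHS]addrCA addrAC addrC lerD2l /served.
have c0 := link_cost_ge0 x s; have w0 := workload_ge0 s.
case: (leP delta (link_cost x s + workload s)) => cmp.
  rewrite max_r; last by lra.
  by have := sqr_ge0 (link_cost x s - delta); rewrite sqrrB; lra.
rewrite max_l; last by lra.
rewrite mulr0 addr0.
move: (link_cost x s) (workload s) c0 w0 cmp => c w c0 w0 cmp.
have : 0 <= w * (2 * delta - 2 * c - w) by rewrite mulr_ge0 //; lra.
rewrite sqrrD; lra.
Qed.

(** Induction along the order: if the successor y of x lies in V, join x to y and stop; otherwise
    attach y first, which gives a tree that contains y and still misses x. *)
Lemma attach_along s x V : uniq (x :: s) -> x \notin V ->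
  exists W, [/\ V \subset W, x \in W, W \subset V :|: [set y in x :: s] &
    S W - delta * #|W|%:R <=
    S V - delta * #|V|%:R + link_cost x s + workload s - delta].
Proof.
elim: s x V => [|y s IH] x V us xV.
  exists (x |: V); split; first exact: finset.subsetUr.
  - by rewrite !inE eqxx.
  - by apply/fintype.subsetP => z; rewrite !inE orbC.
  rewrite /= cardsU1 xV add1n -natr1; have := S_far V x; lra.
have xy : x != y by move: us; rewrite /= inE negb_or => /andP[/andP[]].
have [yV|yV] := boolP (y \in V).
  exists (x |: V); split; first exact: finset.subsetUr.
  - by rewrite !inE eqxx.
  - by apply/fintype.subsetP => z; rewrite !inE => /orP[->|->]; rewrite ?orbT.
  rewrite cardsU1 xV add1n -natr1.
  have := S_attach x yV; have := workload_ge0 (y :: s); rewrite /link_cost; lra.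
have uys : uniq (y :: s) by move: us => /= /andP[].
have [W [VW yW WV le]] := IH y V uys yV.
have xW : x \notin W.
  apply: contra xV => xW; have := fintype.subsetP WV _ xW; rewrite !inE.
  case/orP => //; move: us => /= /andP[]; rewrite inE => /negP xs _ xs'.
  by case: xs.
exists (x |: W); split.
- by apply: fintype.subset_trans VW _; exact: finset.subsetUr.
- by rewrite !inE eqxx.
- apply/fintype.subsetP => z; rewrite !inE => /orP[->|zW]; first by rewrite orbT.
  by have := fintype.subsetP WV _ zW; rewrite !inE => /orP[->//|->]; rewrite !orbT.
rewrite cardsU1 xW add1n -natr1.
have := S_attach x yW.
have : link_cost y s + workload s - delta <= workload (y :: s).
  by rewrite /= le_max lexx orbT.
rewrite [link_cost x _]/=; lra.
Qed.

Lemma truncation_setD1_le x s X : uniq (x :: s) -> {subset x :: s <= X} ->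
  0 <= truncation X - truncation (X :\ x) <= served x s.
Proof.
move=> us sX; have xX : x \in X by apply: sX; rewrite mem_head.
rewrite -{1 3}(finset.setD1K xX) subr_ge0 truncation_mono /= /served le_min.
rewrite lerBlDl truncation_lip /= lerBlDl finset.setD1K //.
have [V VX ->] := truncation_attained (X :\ x).
have xV : x \notin V by apply/negP => /(fintype.subsetP VX); rewrite !inE eqxx.
have [W [VW xW WV le]] := attach_along us xV.
have VX' : V \subset X by apply: fintype.subset_trans VX _; exact: finset.subsetDl.
have WX : W \subset X.
  apply/fintype.subsetP => z /(fintype.subsetP WV); rewrite !inE => /orP[/(fintype.subsetP VX')//|zs].
  by apply: sX; rewrite inE.
apply: le_trans (truncation_le WX) _; rewrite (card_diff WX) (card_diff VX).
have -> : #|X|%:R = #|X :\ x|%:R + 1 :> R by rewrite (cardsD1 x X) xX add1n natr1.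
move: le; lra.
Qed.

(** The increment at a point involves only the part of the order after it, so the bounds [served]
    can be summed by recursion on the order; the final potential is nonnegative and is dropped. *)
Lemma truncation_efron_stein s X : uniq s -> s =i X ->
  \sum_(b in X) (truncation X - truncation (X :\ b)) ^+ 2 <= sqr_cost s.
Proof.
move=> us sX.
have -> : \sum_(b in X) (truncation X - truncation (X :\ b)) ^+ 2 =
    \sum_(b <- s) (truncation X - truncation (X :\ b)) ^+ 2.
  by rewrite big_uniq //; apply: eq_bigl => b; rewrite sX.
have subX : {subset s <= X} by move=> x; rewrite sX.
apply: (@le_trans _ _ (sqr_served s)); last first.
  apply: le_trans (sqr_served_le s); rewrite lerDl mulr_ge0 ?workload_ge0 //.
  by rewrite mulr_ge0 // ltW.
elim: s us subX {sX} => [|x s IH] us sX; first by rewrite big_nil.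
rewrite big_cons /=; apply: lerD.
  have /andP[t0 t1] := truncation_setD1_le us sX.
  by rewrite ler_sqr ?nnegrE // (le_trans t0).
by apply: IH => [|y ys]; [case/andP: us | apply: sX; rewrite inE ys orbT].
Qed.

(** The points of [s] are added to an optimal V from the end of the order backwards. A new point
    costs at most its link c and saves the penalty delta, and c - delta <= c^2 / (4 delta). *)
Lemma truncation_ge s X : s =i X -> S X <= truncation X + sqr_cost s / (4 * delta).
Proof.
move=> sX; have [V VX ->] := truncation_attained X.
have all_attached : S (V :|: [set y in s]) - delta * #|V :|: [set y in s]|%:R <=
    S V - delta * #|V|%:R + sqr_cost s / (4 * delta).
  elim: s {sX} => [|x s IH] /=.
    rewrite mul0r addr0 (_ : V :|: _ = V) //.
    by apply/setP => y; rewrite !inE orbF.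
  set U := V :|: [set y in s] in IH *.
  have -> : V :|: [set y in x :: s] = x |: U by apply/setP => y; rewrite !inE orbCA.
  have c0 : link_cost x s - delta <= link_cost x s ^+ 2 / (4 * delta).
    rewrite ler_pdivlMr ?mulr_gt0 //.
    have := sqr_ge0 (link_cost x s - 2 * delta); rewrite sqrrB; lra.
  rewrite mulrDl.
  have [xU|xU] := boolP (x \in U).
    have -> : x |: U = U by apply/finset.setUidPr; rewrite finset.sub1set.
    have : 0 <= link_cost x s ^+ 2 / (4 * delta).
      by rewrite divr_ge0 ?sqr_ge0 // mulr_ge0 // ltW.
    lra.
  have SU : S (x |: U) <= S U + link_cost x s.
    case: {c0} s @U xU {IH} => [|y s] U xU /=; first exact: S_far.
    by apply: S_attach; rewrite !inE eqxx orbT.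
  rewrite cardsU1 xU add1n -natr1; lra.
have UX : V :|: [set y in s] = X.
  apply/setP => y; rewrite !inE sX; case: (boolP (y \in V)) => //= yV.
  by rewrite (fintype.subsetP VX).
rewrite UX in all_attached; rewrite card_diff //; lra.
Qed.

End Truncation.

(** * Steiner length *)

Section SteinerLength.
Variable R : realType.
Implicit Types (H V : {fset R * R}) (p q x v : R * R).
Local Notation dist := (@euclidean_dist R).
Local Notation steiner := (@steiner_length R).

Lemma dist_ge0 p q : 0 <= dist p q. Proof. exact: sqrtr_ge0. Qed.

Lemma dist_sqr p q : dist p q ^+ 2 = (p.1 - q.1) ^+ 2 + (p.2 - q.2) ^+ 2.
Proof. by rewrite sqr_sqrtr // addr_ge0 ?sqr_ge0. Qed.

Lemma distC p q : dist p q = dist q p.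
Proof. by congr Num.sqrt; ring. Qed.

Lemma total_length_ge0 V (e : rel V) : 0 <= total_length e.
Proof.
rewrite mulr_ge0 ?invr_ge0 //; apply: sumr_ge0 => x _.
by apply: sumr_ge0 => y _; exact: dist_ge0.
Qed.

Let lengths H := [set l : R | exists V (e : rel V),
  connected_graph_through H e /\ l = total_length e]%classic.

Let lengths_lb H : lbound (lengths H) 0.
Proof. by move=> _ [V [e [_ ->]]]; exact: total_length_ge0. Qed.

Let lengths_nonempty H : (lengths H !=set0)%classic.
Proof.
pose e : rel H := fun y z => y != z.
exists (total_length e), H, e; split=> //; split => //.
- by move=> x y; rewrite /e eq_sym.
- by move=> x; rewrite /e eqxx.
- move=> x y; have [->|xy] := eqVneq x y; first exact: connect0.
  exact: connect1.
Qed.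

Lemma steiner_le H V (e : rel V) : connected_graph_through H e ->
  steiner H <= total_length e.
Proof.
move=> He; apply: ge_inf; last by exists V, e.
by exists 0; exact: lengths_lb.
Qed.

Lemma steiner_ge H (c : R) :
  (forall V (e : rel V), connected_graph_through H e -> c <= total_length e) ->
  c <= steiner H.
Proof.
move=> cle; apply: lb_le_inf; first exact: lengths_nonempty.
by move=> _ [V [e [He ->]]]; exact: cle.
Qed.

Lemma steiner_ge0 H : 0 <= steiner H.
Proof. by apply: steiner_ge => V e _; exact: total_length_ge0. Qed.

Lemma steiner_mono H H' : (H `<=` H')%fset -> steiner H <= steiner H'.
Proof.
move=> sub; apply: steiner_ge => V e [H'V es ei ec]; apply: steiner_le; split => //.
exact: fsubset_trans H'V.
Qed.

Lemma steiner1 x : steiner [fset x]%fset <= 0.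
Proof.
pose e : rel [fset x]%fset := fun _ _ => false.
apply: le_trans (_ : total_length e <= 0).
  apply: steiner_le; split => //; move=> y z.
  rewrite (_ : y = z) ?connect0 //; apply/val_inj.
  by have /fset1P -> := valP y; have /fset1P -> := valP z.
by rewrite /total_length big1 ?mulr0 // => y _; rewrite big_pred0.
Qed.

Section AddLeaf.
Variables (V : {fset R * R}) (e : rel V) (x v : R * R).
Hypothesis e_sym : symmetric e.
Hypothesis e_irr : irreflexive e.
Hypothesis xV : x \notin V.
Hypothesis vV : v \in V.

(** The vertices of V and of the enlarged graph have different types; transporting the edges to
    points of the plane makes the two graphs comparable. *)
Let e0 p q := oapp (fun u : V => oapp (e u) false (insub q)) false (insub p).
Let e0_val (u w : V) : e0 (val u) (val w) = e u w.
Proof. by rewrite /e0 !valK. Qed.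
Let e0_in p q : e0 p q -> (p \in V) && (q \in V).
Proof.
rewrite /e0; case: (insubP _ p) => //= u pV _.
by case: (insubP _ q) => //= w qV _ _; rewrite pV qV.
Qed.

Let leaf p q := (p == x) && (q == v).
Definition add_leaf : rel (x |` V)%fset :=
  fun y z => [|| e0 (val y) (val z), leaf (val y) (val z) | leaf (val z) (val y)].

Let xv : x != v. Proof. by apply: contraNneq xV => ->. Qed.

Lemma add_leaf_sym : symmetric add_leaf.
Proof.
have e0s p q : e0 p q -> e0 q p.
  move=> h; have /andP[pV qV] := e0_in h.
  by move: h; rewrite -[p]/(val [` pV]%fset) -[q]/(val [` qV]%fset) !e0_val e_sym.
move=> y z; rewrite /add_leaf; congr (_ || _); last exact: orbC.
by apply/idP/idP => /e0s.
Qed.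

Lemma add_leaf_irr : irreflexive add_leaf.
Proof.
move=> y; apply/negP; rewrite /add_leaf orbb => /orP[h|/andP[/eqP -> /eqP E]].
  have /andP[pV _] := e0_in h.
  by move: h; rewrite -[val y]/(val [` pV]%fset) e0_val e_irr.
by move: xv; rewrite E eqxx.
Qed.

Lemma add_leaf_connect : (forall y z, connect e y z) -> forall y z, connect add_leaf y z.
Proof.
move=> ec.
have inj (u : V) : val u \in (x |` V)%fset by rewrite !inE (valP u) orbT.
pose iota (u : V) : (x |` V)%fset := [` inj u]%fset.
have ci u w : connect add_leaf (iota u) (iota w).
  have /connectP[p pp ->] := ec u w; elim: p u pp => [|z p IH] u /=.
    by move=> _; exact: connect0.
  case/andP=> uz pp; apply: connect_trans (IH z pp); apply: connect1.
  by rewrite /add_leaf /= e0_val uz.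
have xX : x \in (x |` V)%fset by rewrite !inE eqxx.
pose v0 : V := [` vV]%fset.
have cx : connect add_leaf [` xX]%fset (iota v0).
  by apply: connect1; rewrite /add_leaf /leaf /= !eqxx orbT.
have csym := sym_connect_sym add_leaf_sym.
have all_v y : connect add_leaf y (iota v0).
  have := valP y; rewrite !inE => /orP[/eqP E|yV].
    by have -> : y = [` xX]%fset by exact: val_inj.
  by have -> : y = iota [` yV]%fset; [exact: val_inj | exact: ci].
by move=> y z; apply: connect_trans (all_v y) _; rewrite csym.
Qed.

(** Both lengths become double sums over points of the plane, where the new edge occurs as (x, v)
    and as (v, x), which cancels the factor 1/2. *)
Lemma add_leaf_length : total_length add_leaf = total_length e + dist x v.
Proof.
pose G p q := if e0 p q then dist p q else 0.
pose G' p q := if [|| e0 p q, leaf p q | leaf q p] then dist p q else 0.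
have -> : total_length e = 2^-1 * \sum_(p <- V) \sum_(q <- V) G p q.
  rewrite /total_length big_seq_fsetE /=; congr (_ * _); apply: eq_bigr => u _.
  rewrite big_seq_fsetE /= big_mkcond; apply: eq_bigr => w _.
  by rewrite /G e0_val.
have -> : total_length add_leaf =
    2^-1 * \sum_(p <- (x |` V)%fset) \sum_(q <- (x |` V)%fset) G' p q.
  rewrite /total_length big_seq_fsetE /=; congr (_ * _); apply: eq_bigr => u _.
  by rewrite big_seq_fsetE /= big_mkcond; apply: eq_bigr => w _.
have e0x q : (e0 x q = false) * (e0 q x = false).
  by split; apply/negP => /e0_in; rewrite (negPf xV) ?andbF.
have G'V p q : p \in V -> q \in V -> G' p q = G p q.
  move=> pV qV; rewrite /G' /G /leaf.
  have px : p == x = false by apply: contraNF xV => /eqP <-.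
  have qx : q == x = false by apply: contraNF xV => /eqP <-.
  by rewrite px qx /= orbF.
have G'x q : q \in V -> (G' x q = if q == v then dist x v else 0) *
                        (G' q x = if q == v then dist x v else 0).
  move=> qV; have qx : q == x = false by apply: contraNF xV => /eqP <-.
  rewrite /G' /leaf !e0x qx eqxx /= !orbF; split; case: eqP => [->|] //.
  exact: distC.
have sumv : \sum_(q <- V) (if q == v then dist x v else 0) = dist x v.
  rewrite (big_fsetD1 v) //= eqxx big_seq big1 ?addr0 // => z.
  by rewrite !inE => /andP[/negPf ->].
rewrite big_fsetU1 //= big_fsetU1 //=.
have -> : G' x x = 0 by rewrite /G' /leaf e0x eqxx (negPf xv).
have -> : \sum_(q <- V) G' x q = dist x v.
  by rewrite -[RHS]sumv; apply: eq_big_seq => q qV; rewrite G'x.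
have -> : \sum_(p <- V) \sum_(q <- (x |` V)%fset) G' p q =
    dist x v + \sum_(p <- V) \sum_(q <- V) G p q.
  rewrite -{1}sumv -big_split /=; apply: eq_big_seq => p pV.
  rewrite big_fsetU1 //= G'x //; congr (_ + _).
  by apply: eq_big_seq => q qV; rewrite G'V.
by field.
Qed.

End AddLeaf.

(** Every graph through H is extended, so the bound passes to the infimum without a minimiser: if x
    is already a vertex the graph is kept, otherwise x becomes a leaf at v. *)
Lemma steiner_attach H x v : v \in H -> steiner (x |` H)%fset <= steiner H + dist x v.
Proof.
move=> vH; rewrite -lerBlDr; apply: steiner_ge => V e [HV es ei ec].
rewrite lerBlDr; have [xV|xV] := boolP (x \in V).
  apply: le_trans (_ : _ <= total_length e) _; last by rewrite lerDl dist_ge0.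
  by apply: steiner_le; split => //; rewrite fsubUset fsub1set xV.
have vV : v \in V := fsubsetP HV _ vH.
rewrite -(add_leaf_length e xV vV); apply: steiner_le; split.
- exact: fsetUS.
- exact: add_leaf_sym.
- exact: add_leaf_irr.
- exact: add_leaf_connect.
Qed.

End SteinerLength.

(** * Monotonicity and the union bound *)

Section ProbabilityBounds.
Variables (R : realType) (T : finType) (mu : {set T} -> R).
Hypothesis mu_ge0 : forall B, 0 <= mu B.

Lemma Pr_le (E F : pred {set T}) : (forall X, E X -> F X) -> Pr mu E <= Pr mu F.
Proof.
move=> EF; rewrite /Pr big_mkcond [leRHS]big_mkcond; apply: ler_sum => X _.
by case: ifP => [/EF -> //|_]; case: ifP.
Qed.

Lemma Pr_orb_le (E F : pred {set T}) :
  Pr mu (fun X => E X || F X) <= Pr mu E + Pr mu F.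
Proof.
rewrite /Pr big_mkcond [X in _ <= X + _]big_mkcond [X in _ <= _ + X]big_mkcond.
rewrite -big_split; apply: ler_sum => X _ /=.
by case: (E X) (F X) => [] []; rewrite ?addr0 ?add0r // lerDl.
Qed.

End ProbabilityBounds.

(** * Steiner lengths of points in the unit square *)

Section SteinerOfPoints.
Variables (R : realType) (N : nat) (a : 'I_N -> R * R).
Hypothesis a_square : forall i, in_unit_square (a i).
Implicit Types V W X : {set 'I_N}.

Definition steiner_of X : R := steiner_length [fset a i | i in X]%fset.
Definition point_dist i j : R := euclidean_dist (a i) (a j).
Local Notation far := (Num.sqrt 2 : R).

Lemma steiner_of_mono V W : V \subset W -> steiner_of V <= steiner_of W.
Proof.
move=> /fintype.subsetP VW; apply: steiner_mono; apply/fsubsetP => p /imfsetP[i /= iV ->].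
by apply/imfsetP; exists i => //=; exact: VW.
Qed.

Lemma fset_points_setU1 V x :
  [fset a i | i in x |: V]%fset = (a x |` [fset a i | i in V])%fset.
Proof.
apply/fsetP => p; rewrite !inE; apply/imfsetP/orP => /=.
  case=> i; rewrite !inE => /orP[/eqP -> ->|iV ->]; first by left.
  by right; apply/imfsetP; exists i.
case=> [/eqP ->|/imfsetP[i /= iV ->]]; first by exists x; rewrite // !inE eqxx.
by exists i; rewrite // !inE iV orbT.
Qed.

Lemma steiner_of_attach V x v : v \in V ->
  steiner_of (x |: V) <= steiner_of V + point_dist x v.
Proof.
move=> vV; rewrite /steiner_of fset_points_setU1; apply: steiner_attach.
by apply/imfsetP; exists v.
Qed.

Lemma point_dist_le x y : point_dist x y <= far.
Proof.
have [/andP[x1 x2] /andP[x3 x4]] := a_square x.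
have [/andP[y1 y2] /andP[y3 y4]] := a_square y.
rewrite /point_dist /euclidean_dist ler_sqrt //.
have : 0 <= (1 - ((a x).1 - (a y).1)) * (1 + ((a x).1 - (a y).1)) by apply: mulr_ge0; lra.
have : 0 <= (1 - ((a x).2 - (a y).2)) * (1 + ((a x).2 - (a y).2)) by apply: mulr_ge0; lra.
lra.
Qed.

Lemma steiner_of_far V x : steiner_of (x |: V) <= steiner_of V + far.
Proof.
have [->|[v vV]] := set_0Vmem V.
  apply: (@le_trans _ _ 0); last by rewrite addr_ge0 ?steiner_ge0 ?sqrtr_ge0.
  rewrite /steiner_of fset_points_setU1 (_ : [fset a i | i in @finset.set0 (ordinal N)]%fset = fset0).
    by rewrite fsetU0 steiner1.
  by apply/fsetP => p; rewrite inE; apply/imfsetP => -[i] /=; rewrite inE.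
by apply: le_trans (steiner_of_attach x vV) _; rewrite lerD2l point_dist_le.
Qed.

(** 18 = 16 + 2: the steps from and to the artificial ends (2,0) and (0,2) are dropped, and the last
    point contributes far^2 = 2. *)
Lemma short_order X : exists s : seq 'I_N,
  [/\ uniq s, s =i X & sqr_cost point_dist far s <= 18].
Proof.
have [|s ps bound] := @unit_square_order R _ a (enum X).
  by move=> i _; exact: a_square.
exists s; split.
- by rewrite (perm_uniq ps) enum_uniq.
- by move=> i; rewrite (perm_mem ps) mem_enum.
have far2 : far ^+ 2 = 2 by rewrite sqr_sqrtr.
have tail_le x s' q : sqr_cost point_dist far (x :: s') - 2 <= sqr_path a (a x) s' q.
  elim: s' x => [|y s' IH] x; first by rewrite /= addr0 far2 subrr addr_ge0 ?sqr_ge0.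
  have -> : sqr_cost point_dist far [:: x, y & s'] =
    point_dist x y ^+ 2 + sqr_cost point_dist far (y :: s') by [].
  have -> : sqr_path a (a x) (y :: s') q =
    ((a x).1 - (a y).1) ^+ 2 + ((a x).2 - (a y).2) ^+ 2 + sqr_path a (a y) s' q by [].
  by rewrite dist_sqr -addrA lerD2l.
case: s {ps} bound => [|x s'] /= bound; first by rewrite ler0n.
have := tail_le x s' (0, 2).
move: bound; rewrite /=; set z := sqr_path _ _ _ _.
have : 0 <= (2 - (a x).1) ^+ 2 + (0 - (a x).2) ^+ 2 by rewrite addr_ge0 ?sqr_ge0.
move: (_ ^+ 2 + sqr_cost _ _ _) => c; lra.
Qed.

End SteinerOfPoints.

(** * Concentration of the Steiner length about its median *)

Unset Implicit Arguments.

Theorem theorem4p7 (R : realType) (n N : nat) (a : 'I_N -> R * R)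
    (mu : {set 'I_N} -> R) (hn : (2 <= n)%N) (hnN : (n <= N)%N)
    (a_inj : injective a) (a_square : forall i, in_unit_square (a i))
    (mu_distr : subset_distribution n mu)
    (mu_pos : positive_denominators n mu)
    (mu_rho : inhomogeneity n mu < 1) :
  let S := fun X : {set 'I_N} => steiner_length [fset a i | i in X]%fset in
  forall M : R, is_median mu S M ->
  forall t : R, 0 <= t ->
    Pr mu (fun X => t <= `|S X - M|) <=
      4 * expR (- (t ^+ 2 * (1 - inhomogeneity n mu) / (52 * 10 ^+ 4))).
Proof.
move=> S M [med_le med_ge] t t0; set tau := 1 - inhomogeneity n mu.
have tau0 : 0 < tau by rewrite subr_gt0.
have mu_ge0 B : 0 <= mu B by case: mu_distr.
set x := t ^+ 2 * tau / _.
(* For x <= 3/4 the right side is at least 4 (1 - x) >= 1. *)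
have [x_small|x_large] := leP x (3 / 4).
  apply: (@le_trans _ _ 1).
    case: mu_distr => _ _ <-; rewrite /Pr big_mkcond; apply: ler_sum => X _.
    by case: ifP.
  have := expR_ge1Dx (- x); lra.
have tpos : 0 < t.
  rewrite lt_neqAle t0 andbT; apply: contraTneq x_large => t00.
  by rewrite -leNgt /x -t00 expr0n /= !mul0r divr_ge0.
(* This delta makes the truncation error 18 / (4 delta) equal to 9/2 u, while u * delta = 1 stays
   below 3/50 * 18, as [upper_tail_le] requires. The 7 leaves room for the truncation error, the
   distance from the mean to the median and the deviation u of [f]. *)
pose u := t / 7; pose delta := u^-1.
have u0 : 0 < u by rewrite divr_gt0.
have delta0 : 0 < delta by rewrite invr_gt0.
have ud1 : u * delta = 1 by rewrite mulfV // gt_eqF.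
pose d := point_dist a; pose far : R := Num.sqrt 2.
have d0 i j : 0 <= d i j by exact: dist_ge0.
have far0 : 0 <= far by exact: sqrtr_ge0.
pose f := truncation (steiner_of a) delta.
have f_le (X : {set 'I_N}) : f X <= S X by exact: truncation_le_id.
have f_ge (X : {set 'I_N}) : S X <= f X + 9 / 2 * u.
  have [s [us sX s18]] := short_order a_square X.
  apply: le_trans (truncation_ge delta0 (steiner_of_attach a)
    (steiner_of_far a_square) sX) _.
  rewrite lerD2l ler_pdivrMr ?mulr_gt0 //.
  have -> : 9 / 2 * u * (4 * delta) = 18 * (u * delta) by field.
  by rewrite ud1 mulr1.
have f_mono (B : {set 'I_N}) b : f B <= f (b |: B).
  by apply: truncation_mono => //; exact: steiner_of_mono.
have f_lip (B : {set 'I_N}) b : f (b |: B) <= f B + delta by exact: truncation_lip.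
have es (X : {set 'I_N}) : \sum_(b in X) (f X - f (X :\ b)) ^+ 2 <= 18.
  have [s [us sX s18]] := short_order a_square X; apply: le_trans s18.
  apply: truncation_efron_stein => //.
  - exact: steiner_of_mono.
  - exact: steiner_of_attach.
  - exact: steiner_of_far.
pose m := \sum_X mu X * f X; pose y := u ^+ 2 * tau / (24 * 18).
have hT : (n <= #|'I_N|)%N by rewrite card_ord.
have ud : u * delta <= 3 / 50 * 18 by rewrite ud1; lra.
have upper : Pr mu (fun X => m + u <= f X) <= expR (- y).
  apply: (upper_tail_le hn hT mu_distr mu_pos mu_rho _ (delta := delta)) => //.
  by move=> B b _ _; rewrite ger0_norm ?subr_ge0 // lerBlDl.
(* The hypotheses on the observable do not depend on its sign, so the upper tail bound applies to -
   f. *)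
have lower : Pr mu (fun X => f X <= m - u) <= expR (- y).
  have := @upper_tail_le R _ n mu hn hT mu_distr mu_pos mu_rho (fun X => - f X) 18 delta.
  move=> /(_ _ _ _ u u0 ud) H.
  apply: le_trans (H _ _ _) => //.
  - apply: Pr_le => // X fX.
    have -> : \sum_X0 mu X0 * - f X0 = - m.
      by rewrite /m -sumrN; apply: eq_bigr => Y _; rewrite mulrN.
    lra.
  - move=> B b _ _; rewrite opprK addrC distrC ger0_norm ?subr_ge0 //.
    by rewrite lerBlDl.
  - move=> X _; rewrite (eq_bigr (fun b => (f X - f (X :\ b)) ^+ 2)) // => b _.
    by rewrite -opprD sqrrN.
(* Here 7^2 * 24 * 18 = 21168, far below 260000. *)
have yx : 2 * x <= y.
  have -> : x = t ^+ 2 * tau / 52 / 10 ^+ 4 by rewrite /x invfM mulrA.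
  have -> : y = t ^+ 2 * tau / 52 * (13 / 5292) by rewrite /y /u; field.
  rewrite mulrCA; apply: ler_wpM2l; first by rewrite divr_ge0 // mulr_ge0 ?sqr_ge0 // ltW.
  rewrite ler_pdivrMr ?exprn_gt0 //.
  have -> : (10 : R) ^+ 4 = 10 * 10 * 10 * 10 by ring.
  lra.
(* As y >= 2 x > 3/2, each tail of [f] has probability below 1/2, so a median of [S] cannot lie
   beyond it. *)
have ey : expR (- y) < 2^-1.
  rewrite expRN ltf_pV2 ?posrE ?expR_gt0 //.
  by have := expR_ge1Dx y; lra.
have M_ge : m - u <= M.
  rewrite leNgt; apply/negP => Mlt; move: ey; rewrite ltNge => /negP; apply.
  apply: le_trans med_le (le_trans _ lower); apply: Pr_le => // X SX.
  by have := f_le X; lra.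
have M_le : M <= m + u + 9 / 2 * u.
  rewrite leNgt; apply/negP => Mlt; move: ey; rewrite ltNge => /negP; apply.
  apply: le_trans med_ge (le_trans _ upper); apply: Pr_le => // X SX.
  by have := f_ge X; lra.
apply: (@le_trans _ _ (expR (- y) + expR (- y))); last first.
  have : expR (- y) <= expR (- x) by rewrite ler_expR; lra.
  have := expR_gt0 (- x); lra.
apply: le_trans (lerD upper lower); apply: le_trans (Pr_orb_le mu_ge0 _ _).
(* With M between m - u and m + 11/2 u, and S between f and f + 9/2 u, a deviation of 7 u puts [f]
   at least 3/2 u away from m. *)
apply: Pr_le => // X; rewrite ler_normr => h; apply/orP.
have fl := f_le X; have fg := f_ge X; have tu : t = 7 * u by rewrite /u; field.
by case/orP: h => h; [left | right]; lra.
Qed.
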